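(* Let $Z$ be the complex space $c_0$ endowed with the norm $\|x\|_Z=\|x\|_\infty+\left(\sum_{i=1}^\infty\left|\frac{x(i)}{2^i}\right|^2\right)^{1/2}$ (equivalent to $\|\cdot\|_\infty$), and let $Z''$ be its bidual. Then the set $NA\mathcal{A}_u(c_0;Z'')$ is not dense in $\mathcal{A}_u(c_0;Z'')$.
   Context: All Banach spaces are complex; $c_0$ (the domain) carries its usual supremum norm. For Banach spaces $X,Y$, $\mathcal{A}_u(X;Y)$ is the Banach space of functions $f:B_X\to Y$ that are uniformly continuous on the closed unit ball $B_X$ and holomorphic on the open unit ball, with norm $\|f\|=\sup_{x\in B_X}\|f(x)\|$. $NA\mathcal{A}_u(X;Y)$ is the set of $f\in\mathcal{A}_u(X;Y)$ for which there is $x_0\in B_X$ with $\|f(x_0)\|=\|f\|$. *)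

(* Defs.v *)
From HB Require Import structures.
From mathcomp Require Import all_boot all_order all_algebra.
From mathcomp Require Import complex lra.
From mathcomp Require Import all_classical all_reals all_analysis.

Set Implicit Arguments.
Unset Strict Implicit.
Unset Printing Implicit Defensive.

Import Order.TTheory GRing.Theory Num.Theory.
Import numFieldNormedType.Exports.

Local Open Scope classical_set_scope.
Local Open Scope ring_scope.
Local Open Scope complex_scope.

(* R[i] as a normed space over itself, with the topology of its modulus. *)
HB.instance Definition _ (R : rcfType) := NormedModule.copy R[i] R[i]^o.

(* The norm of a normed space over R[i] takes values in R[i]; it is always the
   image of the real number [rnorm v] (see [rnormE]). *)
Definition rnorm (R : realType) (V : normedModType R[i]) (v : V) : R :=
  complex.Re `|v|.

Section RealNorm.
Variables (R : realType) (V : normedModType R[i]).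
Implicit Types (v w : V) (a : R[i]).

Lemma rnormE v : (rnorm v)%:C = `|v|.
Proof.
rewrite /rnorm; have := normr_ge0 v; case: `|v| => a b.
by rewrite lecE /= => /andP[/eqP -> _].
Qed.

Lemma rnorm_ge0 v : 0 <= rnorm v.
Proof. by rewrite -lecR rnormE normr_ge0. Qed.

Lemma rnormD v w : rnorm (v + w) <= rnorm v + rnorm w.
Proof. by rewrite -lecR rmorphD/= !rnormE ler_normD. Qed.

Lemma rnormZ a v : rnorm (a *: v) = rnorm (a : R[i]) * rnorm v.
Proof.
have : (rnorm (a *: v))%:C = (rnorm (a : R[i]) * rnorm v)%:C.
  by rewrite rmorphM/= !rnormE normrZ.
by case.
Qed.

Lemma rnorm0 : rnorm (0 : V) = 0.
Proof. by rewrite /rnorm normr0. Qed.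

Lemma rnorm0_eq0 v : rnorm v = 0 -> v = 0.
Proof. by move=> v0; apply/normr0_eq0; rewrite -rnormE v0. Qed.

Lemma rnormN v : rnorm (- v) = rnorm v.
Proof. by rewrite /rnorm normrN. Qed.

End RealNorm.

Lemma rnormC (R : realType) (r : R) : rnorm (r%:C : R[i]) = `|r|.
Proof. by rewrite /rnorm normc_def /= expr0n /= addr0 sqrtr_sqr. Qed.

Definition supnorm (R : realType) (T : Type) (V : normedModType R[i])
    (A : set T) (f : T -> V) : R :=
  sup [set rnorm (f t) | t in A].

Section SupNorm.
Variables (R : realType) (T : Type) (V : normedModType R[i]).
Variables (A : set T) (t0 : T).
Hypothesis At0 : A t0.
Implicit Types f g : T -> V.

Definition bounded_on f := exists M : R, forall t, A t -> rnorm (f t) <= M.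

Lemma supnorm_ub f t : bounded_on f -> A t -> rnorm (f t) <= supnorm A f.
Proof.
move=> [M fM] At; apply: ub_le_sup; last by exists t.
by exists M => _ [s As <-]; exact: fM.
Qed.

Lemma supnorm_le f (M : R) :
  (forall t, A t -> rnorm (f t) <= M) -> supnorm A f <= M.
Proof.
move=> fM; apply: ge_sup; first by exists (rnorm (f t0)), t0.
by move=> _ [s As <-]; exact: fM.
Qed.

Lemma supnorm_ge0 f : bounded_on f -> 0 <= supnorm A f.
Proof. by move=> bf; apply: le_trans (supnorm_ub bf At0); exact: rnorm_ge0. Qed.

Lemma supnormD f g : bounded_on f -> bounded_on g ->
  supnorm A (f + g) <= supnorm A f + supnorm A g.
Proof.
move=> bf bg; apply: supnorm_le => t At.
by apply: le_trans (rnormD _ _) _; apply: lerD; exact: supnorm_ub.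
Qed.

Lemma supnormZ (a : R[i]) f : bounded_on f ->
  supnorm A (a *: f) = rnorm (a : R[i]) * supnorm A f.
Proof.
move=> bf; apply/eqP; rewrite eq_le; apply/andP; split.
  apply: supnorm_le => t At; rewrite rnormZ.
  by apply: ler_wpM2l; [exact: rnorm_ge0 | exact: supnorm_ub].
have [->|a0] := eqVneq a 0.
  rewrite rnorm0 mul0r scale0r; apply: supnorm_ge0.
  by exists 0 => t _; rewrite rnorm0.
have na : 0 < rnorm (a : R[i]) by rewrite -ltcR rnormE normr_gt0.
rewrite mulrC -ler_pdivlMr //; apply: supnorm_le => t At.
rewrite ler_pdivlMr // mulrC -rnormZ; apply: (@supnorm_ub (a *: f)) => //.
have [M fM] := bf; exists (rnorm (a : R[i]) * M) => s As.
by rewrite rnormZ; apply: ler_wpM2l; [exact: rnorm_ge0 | exact: fM].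
Qed.

Lemma supnorm_eq0 f : bounded_on f -> supnorm A f = 0 ->
  forall t, A t -> f t = 0.
Proof.
move=> bf f0 t At; apply: rnorm0_eq0; apply/eqP; rewrite eq_le rnorm_ge0 andbT.
by rewrite -f0; exact: supnorm_ub.
Qed.

End SupNorm.

Section C0.
Variable R : realType.

Definition c0_pred : {pred nat -> R[i]} :=
  [pred u : nat -> R[i] | `[< u n @[n --> \oo] --> (0 : R[i]) >]].

Lemma c0_submod_closed : submod_closed c0_pred.
Proof.
split=> [|a u v]; rewrite !inE; first exact: cvg_cst.
move=> u0 v0.
have := cvgD (cvgZl_tmp (k := a) u0) v0.
by rewrite scaler0 addr0; apply.
Qed.

HB.instance Definition _ :=
  GRing.isSubmodClosed.Build _ _ c0_pred c0_submod_closed.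

Record c0 : Type := C0 { c0_seq :> nat -> R[i] ; _ : c0_seq \in c0_pred }.

HB.instance Definition _ := [isSub for c0_seq].
HB.instance Definition _ := [Choice of c0 by <:].
HB.instance Definition _ := [SubChoice_isSubLmodule of c0 by <:].

Lemma c0_cvg (x : c0) : x n @[n --> \oo] --> (0 : R[i]).
Proof. by have := valP x; rewrite inE. Qed.

Lemma c0_bounded (x : c0) : bounded_on setT x.
Proof.
have cx : cvgn x by apply: cvgP; exact: c0_cvg.
have /pinfty_ex_gt0[M _ xM] := cvg_seq_bounded cx.
exists (complex.Re M) => n _; have := xM n Logic.I.
by rewrite /= -rnormE; case: (M) => a b; rewrite lecE /= => /andP[].
Qed.

Definition c0_norm (x : c0) : R[i] := (supnorm setT x)%:C.

Fact c0_normD x y : c0_norm (x + y) <= c0_norm x + c0_norm y.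
Proof.
rewrite /c0_norm -rmorphD/= lecR.
exact: (@supnormD _ _ _ _ 0%N) (c0_bounded x) (c0_bounded y).
Qed.

Fact c0_normZ a x : c0_norm (a *: x) = `|a| * c0_norm x.
Proof.
rewrite /c0_norm -(rnormE (a : R[i])) -rmorphM/=; congr (_%:C).
exact: (@supnormZ _ _ _ _ 0%N) (c0_bounded x).
Qed.

Fact c0_norm_eq0 x : c0_norm x = 0 -> x = 0.
Proof.
move=> -[x0]; apply/val_inj/funext => n.
exact: (supnorm_eq0 (c0_bounded x) x0).
Qed.

HB.instance Definition _ :=
  Lmodule_isNormed.Build R[i] c0 c0_normD c0_normZ c0_norm_eq0.

End C0.

Definition unit_ball (R : realType) (V : normedModType R[i]) : set V :=
  [set v | `|v| <= 1].
Arguments unit_ball {R} V.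

Section UnitBall.
Variables (R : realType) (V : normedModType R[i]).

Lemma unit_ball0 : unit_ball V 0.
Proof. by rewrite /unit_ball/= normr0. Qed.

Lemma unit_ballE (v : V) : unit_ball V v <-> rnorm v <= 1.
Proof. by rewrite /unit_ball/= -rnormE -(rmorph1 (real_complex R)) lecR. Qed.

End UnitBall.

(* The topological dual, with the norm f |-> sup of |f v| over the unit ball. *)
Section Dual.
Variables (R : realType) (V : normedModType R[i]).

Definition dual_pred : {pred V -> R[i]} :=
  [pred f : V -> R[i] | `[< scalar f /\ continuous f >]].

Lemma dual_predP (f : V -> R[i]) :
  reflect (scalar f /\ continuous f) (f \in dual_pred).
Proof. exact: asboolP. Qed.

Lemma dual_submod_closed : submod_closed dual_pred.
Proof.
split=> [|a f g].
  apply/dual_predP; split=> [b u v|v]; last exact: cvg_cst.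
  by change (0 = b * 0 + 0 :> R[i]); rewrite mulr0 addr0.
move=> /dual_predP[lf cf] /dual_predP[lg cg].
apply/dual_predP; split=> [b u v|x].
  change (a * f (b *: u + v) + g (b *: u + v) =
          b * (a * f u + g u) + (a * f v + g v)).
  by rewrite lf lg /= !mulrDr addrACA [a * (b * _)]mulrCA.
have := cvgD (cvgZl_tmp (k := a) (cf x)) (cg x).
exact.
Qed.

HB.instance Definition _ :=
  GRing.isSubmodClosed.Build _ _ dual_pred dual_submod_closed.

Record dual : Type :=
  Dual { dual_fun :> V -> R[i] ; _ : dual_fun \in dual_pred }.

HB.instance Definition _ := [isSub for dual_fun].
HB.instance Definition _ := [Choice of dual by <:].
HB.instance Definition _ := [SubChoice_isSubLmodule of dual by <:].

Lemma dual_scalar (f : dual) : scalar f.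
Proof. by have /dual_predP[] := valP f. Qed.

Lemma dual_continuous (f : dual) : continuous f.
Proof. by have /dual_predP[] := valP f. Qed.

Lemma dualZ (f : dual) a v : f (a *: v) = a * f v.
Proof.
have f0 : f 0 = 0.
  have := dual_scalar f 1 0 0; rewrite scaler0 addr0 /= mul1r => f0.
  by apply: (addrI (f 0)); rewrite addr0 -f0.
by have := dual_scalar f a v 0; rewrite !addr0 f0 addr0.
Qed.

Lemma dual_bounded (f : dual) : bounded_on (unit_ball V) f.
Proof.
pose F : {linear V -> R[i]} :=
  HB.pack (dual_fun f) (GRing.isLinear.Build _ _ _ _ _ (dual_scalar f)).
have F0 : {for 0, continuous F} by exact: dual_continuous.
have /bounded_funP/(_ 1)[M fM] := continuous_linear_bounded 0 F0.
exists (complex.Re M) => v /fM; rewrite /= -rnormE.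
by case: (M) => a b; rewrite lecE /= => /andP[].
Qed.

Definition dual_norm (f : dual) : R[i] := (supnorm (unit_ball V) f)%:C.

Fact dual_normD f g : dual_norm (f + g) <= dual_norm f + dual_norm g.
Proof.
rewrite /dual_norm -rmorphD/= lecR.
exact: (supnormD (unit_ball0 V)) (dual_bounded f) (dual_bounded g).
Qed.

Fact dual_normZ a f : dual_norm (a *: f) = `|a| * dual_norm f.
Proof.
rewrite /dual_norm -(rnormE (a : R[i])) -rmorphM/=; congr (_%:C).
exact: (supnormZ (unit_ball0 V)) (dual_bounded f).
Qed.

Fact dual_norm_eq0 f : dual_norm f = 0 -> f = 0.
Proof.
move=> -[f0]; apply/val_inj/funext => v /=.
have [->|v0] := eqVneq v 0; first by rewrite -(scale0r 0) dualZ mul0r.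
have fv : f (`|v|^-1 *: v) = 0.
  apply: (supnorm_eq0 (dual_bounded f) f0).
  by rewrite /unit_ball/= normfZV.
apply/eqP; move/eqP: fv; rewrite dualZ mulf_eq0 invr_eq0 normr_eq0.
by rewrite (negbTE v0).
Qed.

HB.instance Definition _ :=
  Lmodule_isNormed.Build R[i] dual dual_normD dual_normZ dual_norm_eq0.

End Dual.

Section RenormedC0.
Variable R : realType.
Implicit Types x y : c0 R.

(* Sequences are indexed from 0: the coordinate x i has weight 2^-(i+1), so that
   l2w x is (\sum_(i >= 1) |x(i) / 2^i|^2)^(1/2) in 1-based indexing. *)
Definition l2w_series x : R^nat := series (fun i => rnorm (x i / 2 ^+ i.+1) ^+ 2).

Definition l2w x : R := Num.sqrt (limn (l2w_series x)).

Lemma l2w_seriesS x n :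
  l2w_series x n.+1 = l2w_series x n + rnorm (x n / 2 ^+ n.+1) ^+ 2.
Proof. by rewrite /l2w_series seriesSr. Qed.

Lemma l2w_series_ge0 x n : 0 <= l2w_series x n.
Proof. by apply: sumr_ge0 => i _; exact: sqr_ge0. Qed.

Lemma rnorm_scale (z : R[i]) i :
  rnorm (z / 2 ^+ i.+1 : R[i]) = rnorm (z : R[i]) / 2 ^+ i.+1.
Proof.
have -> : (z / 2 ^+ i.+1 : R[i]) = ((2 ^+ i.+1)^-1 : R)%:C *: (z : R[i]).
  by rewrite fmorphV rmorphXn rmorph_nat /= mulrC.
by rewrite rnormZ rnormC mulrC ger0_norm // invr_ge0 exprn_ge0.
Qed.

Lemma is_cvg_l2w_series x : cvgn (l2w_series x).
Proof.
set M := supnorm setT x.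
have M0 : 0 <= M by apply: (@supnorm_ge0 _ _ _ _ 0%N) => //; exact: c0_bounded.
apply: (@series_le_cvg _ _ (geometric (M ^+ 2) (2^-1))).
- by move=> n; exact: sqr_ge0.
- by move=> n; rewrite /= mulr_ge0 // ?sqr_ge0 // exprn_ge0 // invr_ge0.
- move=> n; rewrite rnorm_scale /= exprMn !exprVn.
  have xM : rnorm (x n) <= M by apply: supnorm_ub => //; exact: c0_bounded.
  apply: ler_pM; rewrite ?sqr_ge0 // ?invr_ge0 ?exprn_ge0 //.
    by rewrite ler_pXn2r // nnegrE // rnorm_ge0.
  rewrite -exprM lef_pV2 ?posrE ?exprn_gt0 // ler_weXn2l ?ler1n //.
  by rewrite muln2 -addnn addSn ltnW // ltnS leq_addr.
- apply: is_cvg_geometric_series.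
  by rewrite ger0_norm ?invr_ge0 // invf_lt1 // ltr1n.
Qed.

Lemma l2w_ge0 x : 0 <= l2w x.
Proof. exact: sqrtr_ge0. Qed.

Lemma l2w_series_le x n : Num.sqrt (l2w_series x n) <= l2w x.
Proof.
rewrite ler_wsqrtr //; apply: nondecreasing_cvgn_le; last exact: is_cvg_l2w_series.
apply/nondecreasing_seqP => k; rewrite l2w_seriesS lerDl.
exact: sqr_ge0.
Qed.

(* Minkowski's inequality on the partial sums, from the triangle inequality for
   the modulus of complex numbers. *)
Lemma l2w_seriesD x y n : Num.sqrt (l2w_series (x + y) n) <=
  Num.sqrt (l2w_series x n) + Num.sqrt (l2w_series y n).
Proof.
elim: n => [|n IHn].
  by rewrite /l2w_series /series /= !big_geq // sqrtr0 addr0.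
rewrite !l2w_seriesS.
have sq z : l2w_series z n = Num.sqrt (l2w_series z n) ^+ 2.
  by rewrite sqr_sqrtr // l2w_series_ge0.
rewrite (sq (x + y)) (sq x) (sq y).
set p := Num.sqrt (l2w_series (x + y) n); set q := Num.sqrt (l2w_series x n).
set r := Num.sqrt (l2w_series y n).
set a := rnorm _; set b := rnorm _; set c := rnorm _.
have abc : a <= b + c.
  by rewrite /a -[(x + y) n]/(x n + y n) mulrDl; exact: rnormD.
apply: (@le_trans _ _ (Num.sqrt ((q + r) ^+ 2 + (b + c) ^+ 2))).
  rewrite ler_wsqrtr // lerD // ler_pXn2r // ?nnegrE //.
  - exact: sqrtr_ge0.
  - by rewrite addr_ge0 // sqrtr_ge0.
  - exact: rnorm_ge0.
  - by rewrite addr_ge0 // rnorm_ge0.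
exact: (le_normcD (Complex q b) (Complex r c)).
Qed.

Lemma l2wD x y : l2w (x + y) <= l2w x + l2w y.
Proof.
have xy0 : 0 <= l2w x + l2w y by rewrite addr_ge0 // l2w_ge0.
rewrite -[leRHS]ger0_norm // -sqrtr_sqr ler_wsqrtr //.
apply: limr_le; first exact: is_cvg_l2w_series.
apply: nearW => n.
rewrite -[leLHS]sqr_sqrtr ?l2w_series_ge0 // ler_pXn2r // ?nnegrE ?sqrtr_ge0 //.
by apply: le_trans (l2w_seriesD x y n) _; apply: lerD; exact: l2w_series_le.
Qed.

Lemma l2wZ (a : R[i]) x : l2w (a *: x) = rnorm (a : R[i]) * l2w x.
Proof.
have wE : l2w_series (a *: x) = rnorm (a : R[i]) ^+ 2 \*: l2w_series x.
  apply/funext => n; rewrite /l2w_series /series /= [RHS]mulr_sumr.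
  apply: eq_bigr => i _; rewrite -exprMn -rnormZ.
  congr (rnorm _ ^+ 2); exact: (esym (mulrA a (x i) _)).
rewrite /l2w wE limZl_tmp; last exact: is_cvg_l2w_series.
by rewrite sqrtrM ?sqr_ge0 // sqrtr_sqr ger0_norm // rnorm_ge0.
Qed.

Lemma l2w_le x : l2w x <= supnorm setT x.
Proof.
set M := supnorm setT x.
have M0 : 0 <= M by apply: (@supnorm_ge0 _ _ _ _ 0%N) => //; exact: c0_bounded.
rewrite -[leRHS]ger0_norm // -sqrtr_sqr ler_wsqrtr //.
apply: limr_le; first exact: is_cvg_l2w_series.
apply: nearW => n; apply: (@le_trans _ _ (M ^+ 2 * (1 - 2^-1 ^+ n))).
  elim: n => [|n IHn].
    by rewrite /l2w_series /series /= big_geq // expr0 subrr mulr0.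
  have -> : 1 - 2^-1 ^+ n.+1 = (1 - 2^-1 ^+ n) + 2^-1 ^+ n.+1 :> R.
    by rewrite exprS; lra.
  rewrite l2w_seriesS mulrDr; apply: lerD => //.
  rewrite rnorm_scale exprMn !exprVn.
  have xM : rnorm (x n) <= M by apply: supnorm_ub => //; exact: c0_bounded.
  apply: ler_pM; rewrite ?sqr_ge0 // ?invr_ge0 ?exprn_ge0 //.
    by rewrite ler_pXn2r // nnegrE // rnorm_ge0.
  by rewrite lef_pV2 ?posrE ?exprn_gt0 // ler_eXnr // exprn_ege1 // ler1n.
by rewrite ler_piMr ?sqr_ge0 // gerBl exprn_ge0 // invr_ge0.
Qed.

Definition renormed_c0 : Type := c0 R.

HB.instance Definition _ := GRing.Lmodule.copy renormed_c0 (c0 R).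

Coercion renormed_c0_seq (x : renormed_c0) : nat -> R[i] := c0_seq x.

Definition renormed_c0_norm (x : renormed_c0) : R[i] :=
  (supnorm setT x + l2w x)%:C.

Fact renormed_c0_normD x y :
  renormed_c0_norm (x + y) <= renormed_c0_norm x + renormed_c0_norm y.
Proof.
rewrite /renormed_c0_norm -rmorphD/= lecR addrACA; apply: lerD (l2wD x y).
exact: (@supnormD _ _ _ _ 0%N) (c0_bounded x) (c0_bounded y).
Qed.

Fact renormed_c0_normZ a x :
  renormed_c0_norm (a *: x) = `|a| * renormed_c0_norm x.
Proof.
rewrite /renormed_c0_norm -(rnormE (a : R[i])) -rmorphM/= mulrDr l2wZ.
congr ((_ + _)%:C); exact: (@supnormZ _ _ _ _ 0%N) (c0_bounded x).
Qed.

Fact renormed_c0_norm_eq0 x : renormed_c0_norm x = 0 -> x = 0.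
Proof.
move=> -[/eqP]; rewrite paddr_eq0 ?l2w_ge0 //; last first.
  by apply: (@supnorm_ge0 _ _ _ _ 0%N) => //; exact: c0_bounded.
by move=> /andP[/eqP x0 _]; apply: c0_norm_eq0; rewrite /c0_norm x0.
Qed.

HB.instance Definition _ := Lmodule_isNormed.Build R[i] renormed_c0
  renormed_c0_normD renormed_c0_normZ renormed_c0_norm_eq0.

Lemma renormed_c0_normE (x : renormed_c0) :
  `|x| = (supnorm setT x + l2w x)%:C.
Proof. by []. Qed.

Lemma renormed_c0_equiv (x : c0 R) :
  `|x| <= `|x : renormed_c0| <= 2%:R * `|x|.
Proof.
rewrite renormed_c0_normE -[`|x|]/(supnorm setT x)%:C.
rewrite -(rmorph_nat (real_complex R)) -rmorphM /= !lecR mulr_natl mulr2n.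
by rewrite lerDl l2w_ge0 lerD2l l2w_le.
Qed.

End RenormedC0.

Section UniformContinuity.
Variables (R : realType) (X Y : normedModType R[i]).
Implicit Type f : X -> Y.

Lemma unif_continuous_subspaceP (A : set X) f :
  unif_continuous (f : subspace A -> Y) <->
  (forall e : R, 0 < e -> exists2 d : R, 0 < d &
    forall x y, A x -> A y -> rnorm (x - y) < d -> rnorm (f x - f y) < e).
Proof.
split=> [ucf e e0|ucf E].
  have : entourage [set xy : Y * Y | ball xy.1 e%:C xy.2].
    by rewrite -entourage_ballE; exists e%:C => //=; rewrite ltcR.
  move=> /ucf[D]; rewrite -entourage_ballE => -[d /= d0 dD] DE.
  have dE : d = (complex.Re d)%:C.
    by move: d0; case: (d) => a b; rewrite ltcE /= => /andP[/eqP -> _].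
  exists (complex.Re d); first by rewrite -ltcR -dE.
  move=> x y Ax Ay xyd.
  suff : ball (f x) e%:C (f y) by rewrite -ball_normE /ball_/= -rnormE ltcR.
  apply: (DE (x, y)); right; do 2?split => //=; apply: dD => /=.
  by rewrite -ball_normE /ball_/= -rnormE dE ltcR.
rewrite -entourage_ballE => -[e /= e0 eE].
have eR : e = (complex.Re e)%:C.
  by move: e0; case: (e) => a b; rewrite ltcE /= => /andP[/eqP -> _].
have /ucf[d d0 fd] : 0 < complex.Re e by rewrite -ltcR -eR.
exists [set xy : X * X | ball xy.1 d%:C xy.2].
  by rewrite -entourage_ballE; exists d%:C => //=; rewrite ltcR.
move=> [x y] /= [->|[Ax [Ay]]].
  by apply: eE => /=; exact: ballxx.
rewrite -ball_normE /ball_/= -rnormE ltcR => xyd; apply: eE => /=.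
by rewrite -ball_normE /ball_/= -rnormE eR ltcR; exact: fd.
Qed.

Lemma unif_continuous_unit_ball_bounded f :
  unif_continuous (f : subspace (unit_ball X) -> Y) ->
  bounded_on (unit_ball X) f.
Proof.
move=> /unif_continuous_subspaceP/(_ 1 ltr01)[d d0 fd].
pose N := (Num.truncn d^-1).+1.
have Nd : (N%:R)^-1 < d.
  by rewrite -[ltRHS]invrK ltf_pV2 ?posrE ?invr_gt0 ?ltr0n // truncnS_gt.
have N0 : 0 < N%:R :> R by rewrite ltr0n.
exists (rnorm (f 0) + N%:R) => x /unit_ballE x1.
pose p k : X := (k%:R / N%:R : R)%:C *: x.
have np k : rnorm (p k) = k%:R / N%:R * rnorm x.
  by rewrite rnormZ rnormC ger0_norm // divr_ge0.
suff step k : (k <= N)%N -> rnorm (f (p k)) <= rnorm (f 0) + k%:R.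
  by have := step N (leqnn N); rewrite /p divff ?gt_eqF // scale1r.
elim: k => [|k IHk] kN; first by rewrite /p mul0r scale0r addr0.
rewrite -natr1 addrA -(subrK (f (p k)) (f (p k.+1))) [X in rnorm X]addrC.
apply: le_trans (rnormD _ _) _; apply: lerD; first exact: IHk (ltnW kN).
have pB j : (j <= N)%N -> unit_ball X (p j).
  move=> jN; apply/unit_ballE; rewrite np mulr_ile1 ?rnorm_ge0 ?divr_ge0 //.
  by rewrite ler_pdivrMr // mul1r ler_nat.
apply: ltW; apply: fd; [exact: pB | exact: pB (ltnW kN) |].
rewrite /p -scalerBl -rmorphB /= -mulrBl -natrB // subSnn mul1r.
rewrite rnormZ rnormC ger0_norm ?invr_ge0 ?ltW //.
by apply: le_lt_trans Nd; rewrite ler_piMr // invr_ge0 ltW.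
Qed.

End UniformContinuity.

(* The space A_u(X; Y). A function on the closed unit ball is represented by its
   extension by 0 to X; holomorphic on the open unit ball means Frechet
   differentiable over R[i] at each of its points. *)
Section Au.
Variables (R : realType) (X Y : normedModType R[i]).
Implicit Type f g : X -> Y.

Definition Au_pred : {pred X -> Y} :=
  [pred f : X -> Y | `[< [/\ forall x, ~ unit_ball X x -> f x = 0,
    unif_continuous (f : subspace (unit_ball X) -> Y) &
    forall x, `|x| < 1 -> differentiable f x] >]].

Lemma Au_predP f : reflect
  [/\ forall x, ~ unit_ball X x -> f x = 0,
    unif_continuous (f : subspace (unit_ball X) -> Y) &
    forall x, `|x| < 1 -> differentiable f x] (f \in Au_pred).
Proof. exact: asboolP. Qed.

Lemma Au_submod_closed : submod_closed Au_pred.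
Proof.
split=> [|a f g].
  apply/Au_predP; split=> [//||x _]; last exact: differentiable_cst.
  apply/unif_continuous_subspaceP => e e0; exists 1 => // x y _ _ _.
  by change (rnorm (0 - 0 : Y) < e); rewrite subrr rnorm0.
move=> /Au_predP[f0 fu fd] /Au_predP[g0 gu gd]; apply/Au_predP; split.
- move=> x xB; change (a *: f x + g x = 0).
  by rewrite f0 // g0 // scaler0 addr0.
- apply/unif_continuous_subspaceP => e e0.
  move/unif_continuous_subspaceP : fu => fu.
  move/unif_continuous_subspaceP : gu => gu.
  pose c := rnorm (a : R[i]) + 1.
  have c0 : 0 < c by rewrite ltr_wpDl // rnorm_ge0.
  have [d d0 df] := fu (e / 2 / c) (divr_gt0 (divr_gt0 e0 (ltr0Sn R 1)) c0).
  have [d' d'0 dg] := gu (e / 2) (divr_gt0 e0 (ltr0Sn R 1)).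
  exists (Num.min d d'); first by rewrite lt_min d0.
  move=> x y Ax Ay; rewrite lt_min => /andP[xyd xyd'].
  change (rnorm ((a *: f x + g x) - (a *: f y + g y)) < e).
  rewrite opprD addrACA -scalerBr [ltRHS]splitr.
  apply: le_lt_trans (rnormD _ _) _; apply: ler_ltD; last exact: dg.
  rewrite rnormZ; apply: (@le_trans _ _ (c * (e / 2 / c))).
    apply: ler_pM; rewrite ?rnorm_ge0 //; first by rewrite lerDl.
    exact: ltW (df _ _ _ _ _).
  by rewrite mulrC divfK // gt_eqF.
- move=> x x1; apply: differentiableD; last exact: gd.
  by apply: differentiableZ; exact: fd.
Qed.

HB.instance Definition _ :=
  GRing.isSubmodClosed.Build _ _ Au_pred Au_submod_closed.

Record Au : Type := MkAu { Au_fun :> X -> Y ; _ : Au_fun \in Au_pred }.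

HB.instance Definition _ := [isSub for Au_fun].
HB.instance Definition _ := [Choice of Au by <:].
HB.instance Definition _ := [SubChoice_isSubLmodule of Au by <:].

Lemma Au_eq0 (f : Au) x : ~ unit_ball X x -> f x = 0.
Proof. by have /Au_predP[+ _ _] := valP f; exact. Qed.

Lemma Au_unif_continuous (f : Au) :
  unif_continuous (f : subspace (unit_ball X) -> Y).
Proof. by have /Au_predP[] := valP f. Qed.

Lemma Au_differentiable (f : Au) x : `|x| < 1 -> differentiable f x.
Proof. by have /Au_predP[_ _ +] := valP f; exact. Qed.

Lemma Au_bounded (f : Au) : bounded_on (unit_ball X) f.
Proof.
exact: unif_continuous_unit_ball_bounded (@Au_unif_continuous f).
Qed.

Definition Au_norm (f : Au) : R[i] := (supnorm (unit_ball X) f)%:C.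

Fact Au_normD (f g : Au) : Au_norm (f + g) <= Au_norm f + Au_norm g.
Proof.
rewrite /Au_norm -rmorphD/= lecR.
exact: (supnormD (unit_ball0 X)) (Au_bounded f) (Au_bounded g).
Qed.

Fact Au_normZ a (f : Au) : Au_norm (a *: f) = `|a| * Au_norm f.
Proof.
rewrite /Au_norm -(rnormE (a : R[i])) -rmorphM/=; congr (_%:C).
exact: (supnormZ (unit_ball0 X)) (Au_bounded f).
Qed.

Fact Au_norm_eq0 (f : Au) : Au_norm f = 0 -> f = 0.
Proof.
move=> -[f0]; apply/val_inj/funext => x /=.
have [xB|xB] := pselect (unit_ball X x); last by rewrite Au_eq0.
exact: (supnorm_eq0 (Au_bounded f) f0).
Qed.

HB.instance Definition _ :=
  Lmodule_isNormed.Build R[i] Au Au_normD Au_normZ Au_norm_eq0.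

Definition norm_attaining : set Au :=
  [set f : Au | exists2 x0, unit_ball X x0 & `|f x0| = `|f|].

End Au.
Arguments Au {R} X Y.
Arguments norm_attaining {R} X Y.

(* Main.v *)
Require Import Defs.
From HB Require Import structures.
From mathcomp Require Import all_boot all_order all_algebra.
From mathcomp Require Import complex ring lra.
From mathcomp Require Import all_classical all_reals all_analysis.

Set Implicit Arguments.
Unset Strict Implicit.
Unset Printing Implicit Defensive.

Import Order.TTheory GRing.Theory Num.Theory.
Import numFieldNormedType.Exports.

Local Open Scope classical_set_scope.
Local Open Scope ring_scope.
Local Open Scope complex_scope.

(* Write J for the inclusion of the ball of c_0 into Z''. If g is close to J and
   |g| is attained at x, choose n with |x(n)| small and y a small multiple of the
   n-th unit vector, so that g is defined on a disc x + zy. For a functional Phi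
   almost norming g(x), Re (|g| - g(x + zy)(Phi)) is a nonnegative harmonic
   function of z which almost vanishes at x, hence by Harnack's inequality at
   x + y: thus |g(x) + g(x + y)| = 2|g|. The norm of Z'', which is
   |F|_oo + (\sum_i |F_i / 2^i|^2)^(1/2) in terms of the coordinates of F, is
   strictly convex, so that g(x + y) = g(x), whereas J(x + y) - J(x) = J(y).

   Harnack's inequality is obtained from complex differentiability alone:
   Goursat's lemma makes the horizontal averages of a harmonic function regular
   enough for the second derivative test, and these averages are compared with
   the strictly subharmonic function 1/|z|^2 - 1/4 on an annulus. *)

(** * Harnack's inequality for complex differentiable functions *)

(** No element of the dual Z' of Z need attain the norm of g(x), so the equality case of the maximum
    principle is out of reach. Harnack's inequality can replace it because its constant depends only
    on the modulus of continuity of g and on the tolerance: the almost norming functional is chosen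
    after that constant. The inequality is needed between two points only, with any positive
    constant, so a barrier does the work of the Poisson kernel. A strictly subharmonic barrier,
    unlike the harmonic log |z|, contradicts an interior minimum even though the four-point
    differences of the averages are known only up to o(t^2). On the side of Z'', the formula for the
    norm rests on the density in Z' of the finite combinations of coordinate functionals: the
    coordinates of an element of Z'' are bounded but need not tend to zero, and all estimates go
    through their truncations. *)

Section CauchyRiemann.
Variable R : realType.
Implicit Types (f : R -> R) (u v : R -> R -> R).

Definition primitive (L : R) f : R -> R :=
  fun x => \int[lebesgue_measure]_(t in `[- L, x]) f t.

Lemma primitive_is_derive L f x : {in `[- L, L], forall t, {for t, continuous f}} ->
  - L < x < L -> is_derive x 1 (primitive L f) (f x).
Proof.
move=> cf /andP[Lx xL].
have [||dF <-] := @continuous_FTC1_closed R f (- L) x L xL _ Lx.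
- apply: continuous_compact_integrable; first exact: segment_compact.
  by apply: continuous_in_subspaceT => t /[!inE] tL; exact: cf.
- by apply: cf; rewrite in_itv /= !ltW.
by rewrite derive1E; exact/derivableP.
Qed.

(** The mean value theorem applies to [g], whose derivative is the error [f t - (k + l * t)]. Later
    integral estimates all reduce to this lemma, so that integrals are handled only as differences
    of primitives. *)
Lemma primitive_affine L f a b (k l e : R) :
  {in `[- L, L], forall t, {for t, continuous f}} ->
  - L < a -> a <= b -> b < L ->
  (forall t, a <= t <= b -> `|f t - (k + l * t)| <= e) ->
  `|primitive L f b - primitive L f a - (k * (b - a) + l * (b ^+ 2 - a ^+ 2) / 2)|
  <= e * (b - a).
Proof.
move=> cf La ab bL fe.
pose g t := primitive L f t - (k * t + l * t ^+ 2 / 2).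
have dg t : a <= t <= b -> is_derive t 1 g (f t - (k + l * t)).
  move=> /andP[at_ tb].
  have dP : is_derive t 1 (primitive L f) (f t).
    by apply: primitive_is_derive => //; rewrite (lt_le_trans La) // (le_lt_trans tb).
  rewrite /g; apply: is_derive_eq; rewrite /GRing.scale/=.
  by field.
have [||c cab] := @MVT_segment _ g (fun t => f t - (k + l * t)) a b ab.
- by move=> t /[!in_itv]/= /andP[/ltW at_ /ltW tb]; apply: dg; rewrite at_.
- apply: derivable_within_continuous => t tab.
  by apply: ex_derive; apply: dg; rewrite in_itv/= in tab.
rewrite /g => gE.
have -> : primitive L f b - primitive L f a -
  (k * (b - a) + l * (b ^+ 2 - a ^+ 2) / 2) = (f c - (k + l * c)) * (b - a).
  by rewrite -gE; field.
rewrite normrM (ger0_norm (_ : 0 <= b - a)) ?subr_ge0 // ler_wpM2r ?subr_ge0 //.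
by apply: fe; rewrite in_itv/= in cab.
Qed.

(* [u + i v] is complex differentiable at [x + i y], with derivative [p + i q]. *)
Definition cauchy_riemann u v (x y : R) := exists p q : R, forall e : R, 0 < e ->
  exists2 d : R, 0 < d & forall s t : R, `|s| < d -> `|t| < d ->
    `|u (x + s) (y + t) - u x y - (p * s - q * t)| <= e * (`|s| + `|t|) /\
    `|v (x + s) (y + t) - v x y - (q * s + p * t)| <= e * (`|s| + `|t|).

Lemma cauchy_riemann_continuous u v x y : cauchy_riemann u v x y ->
  forall e : R, 0 < e -> exists2 d : R, 0 < d & forall s t : R, `|s| < d -> `|t| < d ->
    `|u (x + s) (y + t) - u x y| < e /\ `|v (x + s) (y + t) - v x y| < e.
Proof.
move=> [p [q /(_ 1 ltr01)[d d0 H]]] e e0.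
set C := `|p| + `|q| + 1.
have C0 : 0 < C by rewrite ltr_wpDl // addr_ge0.
exists (Num.min d (e / (2 * C))); first by rewrite lt_min d0 /= divr_gt0 // mulr_gt0.
move=> s t; rewrite !lt_min => /andP[sd se] /andP[td te].
have [Hu Hv] := H _ _ sd td.
have sum : C * (`|s| + `|t|) < e.
  rewrite mulrC -ltr_pdivlMr //.
  have -> : e / C = e / (2 * C) + e / (2 * C) by field; rewrite gt_eqF.
  exact: ltrD.
have b1 : `|p * s - q * t| <= (`|p| + `|q|) * (`|s| + `|t|).
  apply: (le_trans (ler_normB _ _)); rewrite !normrM.
  have := mulr_ge0 (normr_ge0 p) (normr_ge0 t).
  have := mulr_ge0 (normr_ge0 q) (normr_ge0 s); lra.
have b2 : `|q * s + p * t| <= (`|p| + `|q|) * (`|s| + `|t|).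
  apply: (le_trans (ler_normD _ _)); rewrite !normrM.
  have := mulr_ge0 (normr_ge0 p) (normr_ge0 s).
  have := mulr_ge0 (normr_ge0 q) (normr_ge0 t); lra.
split; apply: le_lt_trans sum.
- rewrite -[X in `|X|](subrK (p * s - q * t)); apply: (le_trans (ler_normD _ _)).
  by apply: (le_trans (lerD Hu b1)); rewrite /C; lra.
- rewrite -[X in `|X|](subrK (q * s + p * t)); apply: (le_trans (ler_normD _ _)).
  by apply: (le_trans (lerD Hv b2)); rewrite /C; lra.
Qed.

(* The real part of the integral of u + i v along the boundary of
   [a, b] x [c, d]. *)
Definition boundary_integral L u v (a b c d : R) :=
  (primitive L (u ^~ c) b - primitive L (u ^~ c) a) -
  (primitive L (u ^~ d) b - primitive L (u ^~ d) a) -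
  (primitive L (v b) d - primitive L (v b) c) +
  (primitive L (v a) d - primitive L (v a) c).

Section CR.
Variables (L : R) (u v : R -> R -> R).
Hypothesis uvCR : forall x y, `|x| <= L -> `|y| <= L -> cauchy_riemann u v x y.

Lemma CR_continuous_row y : `|y| <= L ->
  {in `[- L, L], forall x, {for x, continuous (u ^~ y)}}.
Proof.
move=> yL x; rewrite in_itv/= -ler_norml => xL.
apply/cvgrPdist_lt => e e0.
have [d d0 H] := cauchy_riemann_continuous (uvCR xL yL) e0.
exists d => //= t /= xt; rewrite distrC.
have [] := H (t - x) 0; [by rewrite distrC|by rewrite normr0|].
by rewrite addr0 subrKC.
Qed.

Lemma CR_continuous_col x : `|x| <= L ->
  {in `[- L, L], forall y, {for y, continuous (v x)}}.
Proof.
move=> xL y; rewrite in_itv/= -ler_norml => yL.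
apply/cvgrPdist_lt => e e0.
have [d d0 H] := cauchy_riemann_continuous (uvCR xL yL) e0.
exists d => //= t /= xt; rewrite distrC.
have [] := H 0 (t - y); [by rewrite normr0|by rewrite distrC|].
by rewrite addr0 subrKC.
Qed.

Lemma boundary_local x y e : `|x| <= L -> `|y| <= L -> 0 < e ->
  exists2 r : R, 0 < r & forall a b c d, - L < a -> a <= x <= b -> b < L ->
    - L < c -> c <= y <= d -> d < L -> (b - a) + (d - c) < r ->
    `|boundary_integral L u v a b c d| <= e * ((b - a) + (d - c)) ^+ 2.
Proof.
move=> xL yL e0; have [p [q H]] := uvCR xL yL.
have e20 : 0 < e / 2 by rewrite divr_gt0.
have [r r0 Hr] := H _ e20; exists r => //.
move=> a b c d La /andP[ax xb] bL Lc /andP[cy yd] dL abr.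
set h := e / 2 * ((b - a) + (d - c)).
have loc s t : a <= s <= b -> c <= t <= d ->
  `|u s t - ((u x y - p * x + q * y - q * t) + p * s)| <= h /\
  `|v s t - ((v x y - q * x - p * y + q * s) + p * t)| <= h.
  move=> /andP[as_ sb] /andP[ct td].
  have sx : `|s - x| <= b - a by rewrite ler_norml; lra.
  have ty : `|t - y| <= d - c by rewrite ler_norml; lra.
  have [||Hu Hv] := Hr (s - x) (t - y); [lra|lra|].
  rewrite !subrKC in Hu Hv.
  have hh : e / 2 * (`|s - x| + `|t - y|) <= h.
    by apply: ler_wpM2l; [exact: ltW|exact: lerD].
  split; [move: Hu | move: Hv] => /le_trans -/(_ _ hh); apply: le_trans.
  - by rewrite le_eqVlt; apply/orP; left; apply/eqP; congr (`|_|); ring.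
  - by rewrite le_eqVlt; apply/orP; left; apply/eqP; congr (`|_|); ring.
have nL t : - L < t -> t < L -> `|t| <= L by move=> *; rewrite ler_norml !ltW.
have cc : c <= c <= d by rewrite lexx; lra.
have dd : c <= d <= d by rewrite lexx andbT; lra.
have aa : a <= a <= b by rewrite lexx; lra.
have bb : a <= b <= b by rewrite lexx andbT; lra.
have cL : `|c| <= L by apply: nL; lra.
have dL' : `|d| <= L by apply: nL; lra.
have aL : `|a| <= L by apply: nL; lra.
have bL' : `|b| <= L by apply: nL; lra.
have ab : a <= b by lra.
have cd : c <= d by lra.
have := primitive_affine (CR_continuous_row cL) La ab bL
  (fun s sab => (loc s c sab cc).1).
have := primitive_affine (CR_continuous_row dL') La ab bL
  (fun s sab => (loc s d sab dd).1).
have := primitive_affine (CR_continuous_col aL) Lc cd dL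
  (fun s scd => (loc a s aa scd).2).
have := primitive_affine (CR_continuous_col bL') Lc cd dL
  (fun s scd => (loc b s bb scd).2).
rewrite !ler_norml /boundary_integral.
have hE : e * ((b - a) + (d - c)) ^+ 2 = 2 * h * (b - a) + 2 * h * (d - c).
  by rewrite /h; field.
rewrite hE; move: (h) => h'.
move=> /andP[? ?] /andP[? ?] /andP[? ?] /andP[? ?].
by apply/andP; split; lra.
Qed.

End CR.

End CauchyRiemann.

(** * Goursat's lemma on rectangles, by bisection *)

Section GoursatLemma.
Variable R : realType.

Lemma split_dyadic (l : R) k : l / 2 ^+ k = l / 2 ^+ k.+1 + l / 2 ^+ k.+1.
Proof. by rewrite exprS; field; rewrite expf_eq0 pnatr_eq0 andbF. Qed.

Section Goursat.
Variables (L : R) (u v : R -> R -> R).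
Hypothesis uvCR : forall x y, `|x| <= L -> `|y| <= L -> cauchy_riemann u v x y.
Variables (a b c d : R).

Let E x y k := boundary_integral L u v
  x (x + (b - a) / 2 ^+ k) y (y + (d - c) / 2 ^+ k).

(** The contributions of the inner sides cancel, so the four subrectangles add up to the whole and
    one of them carries at least a quarter. *)
Let quarter x y k : exists xy' : R * R,
  [/\ xy'.1 = x \/ xy'.1 = x + (b - a) / 2 ^+ k.+1,
      xy'.2 = y \/ xy'.2 = y + (d - c) / 2 ^+ k.+1 &
      `|E x y k| <= 4 * `|E xy'.1 xy'.2 k.+1|].
Proof.
set A := (b - a) / 2 ^+ k.+1; set B := (d - c) / 2 ^+ k.+1.
have hA : (b - a) / 2 ^+ k = A + A by exact: split_dyadic.
have hB : (d - c) / 2 ^+ k = B + B by exact: split_dyadic.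
have EE : E x y k = E x y k.+1 + E (x + A) y k.+1 + E x (y + B) k.+1 +
                    E (x + A) (y + B) k.+1.
  rewrite /E -/A -/B hA hB !addrA /boundary_integral; ring.
have {EE} : `|E x y k| <= `|E x y k.+1| + `|E (x + A) y k.+1| +
    `|E x (y + B) k.+1| + `|E (x + A) (y + B) k.+1|.
  by rewrite EE; do 2!(apply: le_trans (ler_normD _ _) _; rewrite lerD2r);
    exact: ler_normD.
set e := `|E x y k|; set e1 := `|E x y _|; set e2 := `|E (x + A) y _|.
set e3 := `|E x (y + B) _|; set e4 := `|E _ (y + B) _| => ee.
have [H1|H1] := leP e (4 * e1); first by exists (x, y); split => //; left.
have [H2|H2] := leP e (4 * e2).
  by exists (x + A, y); split => //; [right|left].
have [H3|H3] := leP e (4 * e3).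
  by exists (x, y + B); split => //; [left|right].
exists (x + A, y + B); split; [by right|by right|].
by change (e <= 4 * e4); lra.
Qed.

Let nested (s : nat -> R) (x0 l : R) : 0 <= l -> s 0 = x0 ->
  (forall k, s k.+1 = s k \/ s k.+1 = s k + l / 2 ^+ k.+1) ->
  exists z : R, x0 <= z <= x0 + l /\ forall k, s k <= z <= s k + l / 2 ^+ k.
Proof.
move=> l0 s0 sS.
have lk k : 0 <= l / 2 ^+ k by rewrite divr_ge0 // exprn_ge0.
have lkS k := split_dyadic l k.
have inc : {homo s : m n / (m <= n)%N >-> m <= n}.
  apply/nondecreasing_seqP => k.
  by have := lk k.+1; case: (sS k) => ->; rewrite ?lerDl.
have dec : {homo (fun k => s k + l / 2 ^+ k) : m n / (m <= n)%N >-> n <= m}.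
  apply/nonincreasing_seqP => k.
  by have := lk k.+1; rewrite (lkS k); case: (sS k) => ->; lra.
have ub k : ubound (range s) (s k + l / 2 ^+ k).
  move=> _ [j _ <-]; have [jk|/ltnW kj] := leqP j k.
    by rewrite (le_trans (inc _ _ jk)) // lerDl.
  by rewrite (le_trans _ (dec _ _ kj)) // lerDl.
have H k : s k <= sup (range s) <= s k + l / 2 ^+ k.
  apply/andP; split; last by apply: ge_sup; [exists (s 0), 0|exact: ub].
  by apply: ub_le_sup; [exists (s 0 + l / 2 ^+ 0); exact: ub|exists k].
exists (sup (range s)); split => //.
by have := H 0; rewrite expr0 divr1 s0.
Qed.

Lemma goursat : - L < a -> a <= b -> b < L -> - L < c -> c <= d -> d < L ->
  boundary_integral L u v a b c d = 0.
Proof.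
move=> La ab bL Lc cd dL.
have [F HF] : {F : R -> R -> nat -> R * R | forall x y k,
   [/\ (F x y k).1 = x \/ (F x y k).1 = x + (b - a) / 2 ^+ k.+1,
      (F x y k).2 = y \/ (F x y k).2 = y + (d - c) / 2 ^+ k.+1 &
      `|E x y k| <= 4 * `|E (F x y k).1 (F x y k).2 k.+1|]}.
  exists (fun x y k => projT1 (cid (quarter x y k))) => x y k.
  by case: cid.
pose s := fix s k := if k is j.+1 then F (s j).1 (s j).2 j else (a, c).
have Es k : `|E a c 0| <= 4 ^+ k * `|E (s k).1 (s k).2 k|.
  elim: k => [|k IH]; first by rewrite expr0 mul1r.
  rewrite (le_trans IH) // exprSr -mulrA ler_wpM2l ?exprn_ge0 //.
  by have [] := HF (s k).1 (s k).2 k.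
have [x [ax Hx]] : exists z : R, a <= z <= a + (b - a) /\
    forall k, (s k).1 <= z <= (s k).1 + (b - a) / 2 ^+ k.
  apply: nested => //; first by rewrite subr_ge0.
  by move=> k; have [] := HF (s k).1 (s k).2 k.
have [y [cy Hy]] : exists z : R, c <= z <= c + (d - c) /\
    forall k, (s k).2 <= z <= (s k).2 + (d - c) / 2 ^+ k.
  apply: nested => //; first by rewrite subr_ge0.
  by move=> k; have [] := HF (s k).1 (s k).2 k.
rewrite !subrKC in ax cy.
have /andP[ax1 xb1] := ax; have /andP[cy1 yd1] := cy.
have E0 : E a c 0 = boundary_integral L u v a b c d.
  by rewrite /E expr0 !divr1 !subrKC.
rewrite -E0; apply/eqP; rewrite -normr_le0; apply/ler_addgt0Pl.
suff H (e : R) : 0 < e -> `|E a c 0| <= e by move=> e /H; rewrite addr0.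
move=> e0.
set D := (b - a) + (d - c).
have D0 : 0 <= D by rewrite /D; lra.
(* The [+ 1] covers a rectangle reduced to a point. The factor [4 ^+ k] from the quartering will be
   absorbed by the square of [D / 2 ^+ k]. *)
pose e' := e / (D ^+ 2 + 1).
have D21 : 0 < D ^+ 2 + 1 by rewrite ltr_wpDl // sqr_ge0.
have e'0 : 0 < e' by rewrite divr_gt0.
have xL : `|x| <= L by rewrite ler_norml; lra.
have yL : `|y| <= L by rewrite ler_norml; lra.
have [r r0 Hr] := boundary_local uvCR xL yL e'0.
have sab k : a <= (s k).1 /\ (s k).1 + (b - a) / 2 ^+ k <= b.
  elim: k => [|k [IH1 IH2]]; first by rewrite /= expr0 divr1 subrKC.
  have lkS := split_dyadic (b - a) k.
  have l0 : 0 <= (b - a) / 2 ^+ k.+1.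
    by rewrite divr_ge0 ?subr_ge0 // exprn_ge0.
  by have [[] -> _ _] := HF (s k).1 (s k).2 k; split; lra.
have scd k : c <= (s k).2 /\ (s k).2 + (d - c) / 2 ^+ k <= d.
  elim: k => [|k [IH1 IH2]]; first by rewrite /= expr0 divr1 subrKC.
  have lkS := split_dyadic (d - c) k.
  have l0 : 0 <= (d - c) / 2 ^+ k.+1.
    by rewrite divr_ge0 ?subr_ge0 // exprn_ge0.
  by have [_ [] -> _] := HF (s k).1 (s k).2 k; split; lra.
have [k Dk] : exists k, D / 2 ^+ k < r.
  exists (Num.truncn (D / r)).+1; rewrite ltr_pdivrMr ?exprn_gt0 //.
  rewrite mulrC -ltr_pdivrMr // (lt_trans (truncnS_gt _)) //.
  by rewrite -natrX ltr_nat ltn_expl.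
apply: (le_trans (Es k)).
have [s1 s2] := sab k; have [s3 s4] := scd k.
have := Hr (s k).1 ((s k).1 + (b - a) / 2 ^+ k)
           (s k).2 ((s k).2 + (d - c) / 2 ^+ k).
have -> : (s k).1 + (b - a) / 2 ^+ k - (s k).1 +
   ((s k).2 + (d - c) / 2 ^+ k - (s k).2) = D / 2 ^+ k by rewrite /D; ring.
rewrite -/(E _ _ k) => HE.
have {}HE : `|E (s k).1 (s k).2 k| <= e' * (D / 2 ^+ k) ^+ 2.
  by apply: HE; [lra|exact: Hx|lra|lra|exact: Hy|lra|].
apply: (@le_trans _ _ (4 ^+ k * (e' * (D / 2 ^+ k) ^+ 2))).
  by rewrite ler_wpM2l // exprn_ge0.
have -> : 4 ^+ k * (e' * (D / 2 ^+ k) ^+ 2) = e' * D ^+ 2.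
  have -> : 4 = 2 ^+ 2 :> R by rewrite expr2; lra.
  by rewrite -exprM mulnC exprM; field; rewrite expf_eq0 pnatr_eq0 andbF.
by rewrite /e' mulrAC ler_pdivrMr // ler_pM2l // lerDl.
Qed.

End Goursat.

End GoursatLemma.

(** * Four-point differences of the barrier and of horizontal integrals *)

Section RowIntegrals.
Variable R : realType.

Lemma inv_lower_cubic (x : R) : -1 < x -> 1 - x + x ^+ 2 - x ^+ 3 <= (1 + x)^-1.
Proof.
move=> x1; have x0 : 0 < 1 + x by lra.
rewrite -subr_ge0.
have -> : (1 + x)^-1 - (1 - x + x ^+ 2 - x ^+ 3) = x ^+ 4 / (1 + x).
  by field; lra.
have -> : x ^+ 4 = (x ^+ 2) ^+ 2 by ring.
by rewrite divr_ge0 ?sqr_ge0 // ltW.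
Qed.

(* Strict subharmonicity of 1/|z|^2, in the form needed at points where only
   second differences are available. *)
Lemma barrier_four_point (a b t s : R) : a ^+ 2 + b ^+ 2 = s -> 0 < s ->
  8 * t ^+ 2 <= s ->
  t ^+ 2 / s ^+ 2 <= ((a + t) ^+ 2 + b ^+ 2)^-1 + ((a - t) ^+ 2 + b ^+ 2)^-1 +
    (a ^+ 2 + (b + t) ^+ 2)^-1 + (a ^+ 2 + (b - t) ^+ 2)^-1 - 4 / s.
Proof.
move=> abs s0 ts; have sN0 : s != 0 by rewrite gt_eqF.
(* Each shifted square modulus is [s * (1 + x)] with [w] among [a], [- a], [b], [- b]; in the sum of
   the four cubic bounds the odd powers of [w] cancel. *)
have key (w : R) : let x := (t ^+ 2 + 2 * w * t) / s in w ^+ 2 <= s ->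
    (1 - x + x ^+ 2 - x ^+ 3) / s <= (s + t ^+ 2 + 2 * w * t)^-1.
  rewrite /=; set x := (t ^+ 2 + _) / s => ws.
  have sx : s + t ^+ 2 + 2 * w * t = s * (1 + x) by rewrite /x; field.
  rewrite sx invfM mulrC ler_pM2l ?invr_gt0 // inv_lower_cubic //.
  rewrite -(ltrD2l 1) subrr -(pmulr_rgt0 _ s0) -sx.
  have h : 0 <= s - w ^+ 2 by rewrite subr_ge0.
  have t2 := sqr_ge0 t.
  have := sqr_ge0 (w + 2 * t); have := sqr_ge0 (w + t).
  rewrite !sqrrD !exprMn; lra.
have a2 : a ^+ 2 <= s by rewrite -abs lerDl sqr_ge0.
have b2 : b ^+ 2 <= s by rewrite -abs lerDr sqr_ge0.
have -> : (a + t) ^+ 2 + b ^+ 2 = s + t ^+ 2 + 2 * a * t by rewrite -abs; ring.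
have -> : (a - t) ^+ 2 + b ^+ 2 = s + t ^+ 2 + 2 * - a * t by rewrite -abs; ring.
have -> : a ^+ 2 + (b + t) ^+ 2 = s + t ^+ 2 + 2 * b * t by rewrite -abs; ring.
have -> : a ^+ 2 + (b - t) ^+ 2 = s + t ^+ 2 + 2 * - b * t by rewrite -abs; ring.
have k1 := key a a2; have k2 := key b b2.
have k3 := key (- a); rewrite sqrrN in k3; have {}k3 := k3 a2.
have k4 := key (- b); rewrite sqrrN in k4; have {}k4 := k4 b2.
apply: le_trans (lerB (lerD (lerD (lerD k1 k3) k2) k4) (lexx _)).
set r := t ^+ 2 / s.
have r0 : 0 <= r by rewrite divr_ge0 ?sqr_ge0 // ltW.
have r8 : 8 * r <= 1 by rewrite /r mulrA ler_pdivrMr // mul1r.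
rewrite -subr_ge0.
have -> : (1 - (t ^+ 2 + 2 * a * t) / s + ((t ^+ 2 + 2 * a * t) / s) ^+ 2 -
  ((t ^+ 2 + 2 * a * t) / s) ^+ 3) / s +
 (1 - (t ^+ 2 + 2 * - a * t) / s + ((t ^+ 2 + 2 * - a * t) / s) ^+ 2 -
  ((t ^+ 2 + 2 * - a * t) / s) ^+ 3) / s +
 (1 - (t ^+ 2 + 2 * b * t) / s + ((t ^+ 2 + 2 * b * t) / s) ^+ 2 -
  ((t ^+ 2 + 2 * b * t) / s) ^+ 3) / s +
 (1 - (t ^+ 2 + 2 * - b * t) / s + ((t ^+ 2 + 2 * - b * t) / s) ^+ 2 -
  ((t ^+ 2 + 2 * - b * t) / s) ^+ 3) / s - 4 / s - t ^+ 2 / s ^+ 2 =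
 (3 * r - 20 * r ^+ 2 - 4 * r ^+ 3) / s.
  by move: sN0; rewrite /r -abs => sN0; field.
(* The term [3 * r] is [8 * r] from the squares, less [4 * r] from the linear terms and the [r]
   claimed. Since [r ^+ 2 <= r], the rest is at most [24 * r], which [8 * r <= 1] bounds by 3. *)
apply: divr_ge0; last exact: ltW.
have -> : 3 * r - 20 * r ^+ 2 - 4 * r ^+ 3 = r * (3 - 20 * r - 4 * r ^+ 2) by ring.
rewrite mulr_ge0 //.
have : r ^+ 2 <= r by rewrite expr2 ler_piMr //; lra.
lra.
Qed.

Section RowIntegral.
Variables (L : R) (u v : R -> R -> R).
Hypothesis uvCR : forall x y, `|x| <= L -> `|y| <= L -> cauchy_riemann u v x y.

(** The same [p] serves the horizontal primitive of [u] and the vertical primitive of [v]: this is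
    the equation u_x = v_y, on which the cancellation in [row_integral_four_point] depends. *)
Lemma primitive_taylor (x y : R) : `|x| < L -> `|y| < L -> exists p : R,
  forall e : R, 0 < e -> exists2 r : R, 0 < r & forall t : R, 0 < t -> t < r ->
   let Pu := primitive L (u ^~ y) in let Pv := primitive L (v x) in
   [/\ `|Pu (x + t) - Pu x - (u x y * t + p * t ^+ 2 / 2)| <= e * t ^+ 2,
       `|Pu x - Pu (x - t) - (u x y * t - p * t ^+ 2 / 2)| <= e * t ^+ 2,
       `|Pv (y + t) - Pv y - (v x y * t + p * t ^+ 2 / 2)| <= e * t ^+ 2 &
       `|Pv y - Pv (y - t) - (v x y * t - p * t ^+ 2 / 2)| <= e * t ^+ 2].
Proof.
move=> xL yL; have [p [q H]] := uvCR (ltW xL) (ltW yL).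
exists p => e e0; have [d d0 Hd] := H e e0.
exists (Num.min d (Num.min (L - `|x|) (L - `|y|))).
  by rewrite !lt_min d0 !subr_gt0 xL.
move=> t t0; rewrite !lt_min => /and3P[td tx ty] Pu Pv.
have nx : - L < x - t /\ x + t < L.
  by have := ler_norm x; have := ler_norm (- x); rewrite normrN; split; lra.
have ny : - L < y - t /\ y + t < L.
  by have := ler_norm y; have := ler_norm (- y); rewrite normrN; split; lra.
have ub s : `|s - x| <= t -> `|u s y - (u x y - p * x + p * s)| <= e * t.
  move=> st; have [|] := Hd (s - x) 0 (le_lt_trans st td).
    by rewrite normr0.
  rewrite addr0 subrKC normr0 addr0 => + _ => Hu.
  apply: (@le_trans _ _ (e * `|s - x|)); last by rewrite ler_wpM2l // ltW.
  by apply: le_trans Hu; rewrite le_eqVlt; apply/orP; left; apply/eqP; congr `|_|; ring.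
have vb s : `|s - y| <= t -> `|v x s - (v x y - p * y + p * s)| <= e * t.
  move=> st; have [|] := Hd 0 (s - y) _ (le_lt_trans st td).
    by rewrite normr0.
  rewrite addr0 subrKC normr0 add0r => _ Hv.
  apply: (@le_trans _ _ (e * `|s - y|)); last by rewrite ler_wpM2l // ltW.
  by apply: le_trans Hv; rewrite le_eqVlt; apply/orP; left; apply/eqP; congr `|_|; ring.
have cu := CR_continuous_row uvCR (ltW yL).
have cv := CR_continuous_col uvCR (ltW xL).
split.
- have := @primitive_affine _ L _ x (x + t) (u x y - p * x) p (e * t) cu.
  have -> : (u x y - p * x) * (x + t - x) + p * ((x + t) ^+ 2 - x ^+ 2) / 2 =
    u x y * t + p * t ^+ 2 / 2 by field.
  rewrite (_ : e * t * (x + t - x) = e * t ^+ 2); last by ring.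
  apply; [lra|lra|lra|move=> s /andP[s1 s2]].
  by apply: ub; rewrite ler_norml; apply/andP; split; lra.
- have := @primitive_affine _ L _ (x - t) x (u x y - p * x) p (e * t) cu.
  have -> : (u x y - p * x) * (x - (x - t)) + p * (x ^+ 2 - (x - t) ^+ 2) / 2 =
    u x y * t - p * t ^+ 2 / 2 by field.
  rewrite (_ : e * t * (x - (x - t)) = e * t ^+ 2); last by ring.
  apply; [lra|lra|lra|move=> s /andP[s1 s2]].
  by apply: ub; rewrite ler_norml; apply/andP; split; lra.
- have := @primitive_affine _ L _ y (y + t) (v x y - p * y) p (e * t) cv.
  have -> : (v x y - p * y) * (y + t - y) + p * ((y + t) ^+ 2 - y ^+ 2) / 2 =
    v x y * t + p * t ^+ 2 / 2 by field.
  rewrite (_ : e * t * (y + t - y) = e * t ^+ 2); last by ring.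
  apply; [lra|lra|lra|move=> s /andP[s1 s2]].
  by apply: vb; rewrite ler_norml; apply/andP; split; lra.
- have := @primitive_affine _ L _ (y - t) y (v x y - p * y) p (e * t) cv.
  have -> : (v x y - p * y) * (y - (y - t)) + p * (y ^+ 2 - (y - t) ^+ 2) / 2 =
    v x y * t - p * t ^+ 2 / 2 by field.
  rewrite (_ : e * t * (y - (y - t)) = e * t ^+ 2); last by ring.
  apply; [lra|lra|lra|move=> s /andP[s1 s2]].
  by apply: vb; rewrite ler_norml; apply/andP; split; lra.
Qed.

Variable h : R.

(** Only first derivatives of [u] are at hand, whereas this integral has second-order expansions in
    both variables: in [x] as a primitive, in [y] because Goursat's lemma turns vertical increments
    into integrals of [v]. *)
Definition row_integral (x y : R) := primitive L (u ^~ y) (x + h) - primitive L (u ^~ y) x.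

(** By Goursat's lemma on the rectangles above and below the segment, the vertical second difference
    becomes one of primitives of [v] at [x] and [x + h]. It contributes p0 - p1 times t^2, the
    horizontal one p1 - p0 times t^2. *)
Lemma row_integral_four_point (x y : R) : 0 < h -> `|x| < L -> `|x + h| < L -> `|y| < L ->
  forall e : R, 0 < e -> exists2 r : R, 0 < r & forall t : R, 0 < t -> t < r ->
    `|row_integral (x + t) y + row_integral (x - t) y + row_integral x (y + t) +
      row_integral x (y - t) - 4 * row_integral x y| <= e * t ^+ 2.
Proof.
move=> h0 xL xhL yL e e0.
(* Four Taylor errors at [x] and four at [x + h]. *)
have e80 : 0 < e / 8 by rewrite divr_gt0.
have [p0 /(_ _ e80)[r0 r00 H0]] := primitive_taylor xL yL.
have [p1 /(_ _ e80)[r1 r10 H1]] := primitive_taylor xhL yL.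
exists (Num.min (L - `|y|) (Num.min r0 r1)); first by rewrite !lt_min r00 r10 subr_gt0 yL.
move=> t t0; rewrite !lt_min => /and3P[ty tr0 tr1].
have ny : - L < y - t /\ y + t < L.
  by have := ler_norm y; have := ler_norm (- y); rewrite normrN; split; lra.
have Lx : - L < x by move: xL; rewrite ltr_norml => /andP[].
have xL' : x + h < L by move: xhL; rewrite ltr_norml => /andP[].
have xxh : x <= x + h by rewrite lerDl ltW.
have [Ly yL'] : - L < y /\ y < L by move: yL; rewrite ltr_norml => /andP.
have [ty1 ty2] : y - t <= y /\ y <= y + t by rewrite gerBl lerDl ltW.
have := @goursat _ _ _ _ uvCR x (x + h) y (y + t) Lx xxh xL' Ly ty2 ny.2.
have := @goursat _ _ _ _ uvCR x (x + h) (y - t) y Lx xxh xL' ny.1 ty1 yL'.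
have [] := H0 t t0 tr0; have [] := H1 t t0 tr1.
have xth : x + t + h = x + h + t by ring.
have xth' : x - t + h = x + h - t by ring.
rewrite /boundary_integral /row_integral !ler_norml xth xth'.
repeat match goal with
  |- context [primitive ?L ?f ?z] => generalize (primitive L f z); intro end.
generalize (t ^+ 2) (u x y) (u (x + h) y) (v x y) (v (x + h) y).
clear => ? ? ? ? ? /andP[? ?] /andP[? ?] /andP[? ?] /andP[? ?].
move=> /andP[? ?] /andP[? ?] /andP[? ?] /andP[? ?] ? ?.
by apply/andP; split; lra.
Qed.

End RowIntegral.

End RowIntegrals.

(** * Lipschitz and lower bounds for row integrals *)

Section Estimates.
Variable R : realType.

Section RowIntegralBounds.
Variables (L C : R) (u v : R -> R -> R).
Hypothesis uvCR : forall x y, `|x| <= L -> `|y| <= L -> cauchy_riemann u v x y.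
Hypothesis uC : forall x y, `|x| <= L -> `|y| <= L -> `|u x y| <= C.
Hypothesis vC : forall x y, `|x| <= L -> `|y| <= L -> `|v x y| <= C.

Lemma primitive_row_lip (y a b : R) : `|y| <= L -> `|a| < L -> `|b| < L ->
  `|primitive L (u ^~ y) b - primitive L (u ^~ y) a| <= C * `|b - a|.
Proof.
move=> yL; wlog ab : a b / a <= b => [H aL bL|].
  have [ab|/ltW ba] := leP a b; first exact: H.
  by rewrite distrC [`|b - a|]distrC; exact: H.
rewrite !ltr_norml => /andP[La _] /andP[_ bL].
have := @primitive_affine _ _ _ a b 0 0 C (CR_continuous_row uvCR yL) La ab bL.
rewrite !mul0r !addr0 subr0 [`|b - a|]ger0_norm ?subr_ge0 //; apply=> t /andP[ta tb].
rewrite mul0r addr0 subr0; apply: uC => //.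
by rewrite ler_norml !ltW // ?(lt_le_trans La) // (le_lt_trans tb).
Qed.

Lemma primitive_col_lip (x a b : R) : `|x| <= L -> `|a| < L -> `|b| < L ->
  `|primitive L (v x) b - primitive L (v x) a| <= C * `|b - a|.
Proof.
move=> xL; wlog ab : a b / a <= b => [H aL bL|].
  have [ab|/ltW ba] := leP a b; first exact: H.
  by rewrite distrC [`|b - a|]distrC; exact: H.
rewrite !ltr_norml => /andP[La _] /andP[_ bL].
have := @primitive_affine _ _ _ a b 0 0 C (CR_continuous_col uvCR xL) La ab bL.
rewrite !mul0r !addr0 subr0 [`|b - a|]ger0_norm ?subr_ge0 //; apply=> t /andP[ta tb].
rewrite mul0r addr0 subr0; apply: vC => //.
by rewrite ler_norml !ltW // ?(lt_le_trans La) // (le_lt_trans tb).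
Qed.

Variable h : R.
Hypothesis h0 : 0 < h.

(** Provides the continuity for minimising over a compact annulus. Horizontal moves are controlled
    by the bound on [u]; vertical ones become integrals of [v] along two columns. *)
Lemma row_integral_lip (x y x' y' : R) : `|x| < L -> `|x + h| < L -> `|y| < L ->
  `|x'| < L -> `|x' + h| < L -> `|y'| < L ->
  `|row_integral L u h x' y' - row_integral L u h x y| <=
    2 * C * (`|x' - x| + `|y' - y|).
Proof.
move=> xL xhL yL xL' xhL' yL'.
have C0 : 0 <= C by apply: le_trans (uC (ltW xL) (ltW yL)).
rewrite -[X in `|X|](subrKA (row_integral L u h x y')) mulrDr.
apply: le_trans (ler_normD _ _) _; apply: lerD.
  have b1 := primitive_row_lip (ltW yL') xL xL'.
  have b2 := primitive_row_lip (ltW yL') xhL xhL'.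
  rewrite (_ : x' + h - (x + h) = x' - x) in b2; last by ring.
  have -> : row_integral L u h x' y' - row_integral L u h x y' =
    (primitive L (u ^~ y') (x' + h) - primitive L (u ^~ y') (x + h)) -
    (primitive L (u ^~ y') x' - primitive L (u ^~ y') x).
    by rewrite /row_integral; ring.
  apply: le_trans (ler_normB _ _) _; rewrite [2 * C]mulr_natl mulr2n mulrDl.
  exact: lerD.
have b1 := primitive_col_lip (ltW xL) yL yL'.
have b2 := primitive_col_lip (ltW xhL) yL yL'.
have -> : row_integral L u h x y' - row_integral L u h x y =
    (primitive L (v x) y' - primitive L (v x) y) -
    (primitive L (v (x + h)) y' - primitive L (v (x + h)) y).
  rewrite /row_integral.
  have [Lx hL] : - L < x /\ x + h < L.
    by move: xL xhL; rewrite !ltr_norml => /andP[-> _] /andP[].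
  have xxh : x <= x + h by rewrite lerDl ltW.
  move: yL yL'; rewrite !ltr_norml => /andP[y1 y2] /andP[y3 y4].
  have [yy|/ltW yy] := leP y y'.
    have := @goursat _ _ _ _ uvCR x (x + h) y y' Lx xxh hL y1 yy y4.
    rewrite /boundary_integral => g; lra.
  have := @goursat _ _ _ _ uvCR x (x + h) y' y Lx xxh hL y3 yy y2.
  rewrite /boundary_integral => g; lra.
apply: le_trans (ler_normB _ _) _; rewrite [2 * C]mulr_natl mulr2n mulrDl.
exact: lerD.
Qed.

Lemma row_integral_ge (c x y : R) : `|x| < L -> `|x + h| < L -> `|y| <= L ->
  (forall s, x <= s <= x + h -> c <= u s y) -> c * h <= row_integral L u h x y.
Proof.
move=> xL xhL yL cu.
have [Lx hL] : - L < x /\ x + h < L.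
  by move: xL xhL; rewrite !ltr_norml => /andP[-> _] /andP[].
have xxh : x <= x + h by rewrite lerDl ltW.
(* On the segment [u] lies between [c] and [C], hence within [(C - c) / 2] of their midpoint. *)
have := @primitive_affine _ _ _ x (x + h) ((C + c) / 2) 0 ((C - c) / 2)
  (CR_continuous_row uvCR yL) Lx xxh hL.
rewrite !mul0r !addr0 [x + h]addrC addrK [h + x]addrC => H.
have {H} := H _; rewrite ler_norml => H.
have /andP[H1 _] : - ((C - c) / 2 * h) <= row_integral L u h x y - (C + c) / 2 * h
  <= (C - c) / 2 * h.
  apply: H => s sx; rewrite mul0r addr0 ler_norml.
  have cs := cu s sx.
  have sL : `|s| <= L.
    by rewrite ler_norml; case/andP: sx => ? ?; apply/andP; split; lra.
  have := uC sL yL; rewrite ler_norml => /andP[_ sC].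
  by apply/andP; split; lra.
lra.
Qed.

End RowIntegralBounds.

End Estimates.

(** * Minimum principle against the barrier on an annulus *)

Section Comparison.
Variable R : realType.

Section BarrierBound.
Variables (C c eta : R) (u v : R -> R -> R).

(** The annulus is eta/2 <= |z| <= 2. The barrier vanishes on the outer circle, [m] is chosen to
    keep it below [c * h] on the inner one, and at -1 it equals 3/4 of [h * m], the bound claimed.
    The square of half side 3 leaves room for segments that start in the annulus. *)
Lemma row_integral_barrier (h : R) : 0 < c -> 0 < eta -> eta <= 1 ->
  0 < h -> h <= eta / 2 ->
  (forall x y, `|x| <= 3 -> `|y| <= 3 -> cauchy_riemann u v x y) ->
  (forall x y, `|x| <= 3 -> `|y| <= 3 -> `|u x y| <= C) ->
  (forall x y, `|x| <= 3 -> `|y| <= 3 -> `|v x y| <= C) ->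
  (forall x y, `|x| <= 3 -> `|y| <= 3 -> 0 <= u x y) ->
  (forall x y : R, x ^+ 2 + y ^+ 2 <= eta ^+ 2 -> c <= u x y) ->
  3 * c * eta ^+ 2 / 16 * h <= row_integral 3 u h (-1) 0.
Proof.
move=> c0 eta0 eta1 h0 h_eta uvCR uC vC u0 uc.
set U := row_integral 3 u h.
pose m := c * eta ^+ 2 / 4.
have m0 : 0 < m by rewrite divr_gt0 // mulr_gt0 // exprn_gt0.
pose W (z : R * R) := U z.1 z.2 - h * m * ((z.1 ^+ 2 + z.2 ^+ 2)^-1 - 4^-1).
pose A := [set z : R * R | eta ^+ 2 / 4 <= z.1 ^+ 2 + z.2 ^+ 2 <= 4].
have sq2 (t : R) : t ^+ 2 <= 4 -> -2 <= t <= 2.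
  move=> t4; rewrite -ler_norml -(@ler_pXn2r _ 2) ?nnegrE //.
  by rewrite real_normK ?num_real // expr2; lra.
have Abox z : A z -> (-2 <= z.1 <= 2) /\ (-2 <= z.2 <= 2).
  move=> /andP[_ z4]; have := sqr_ge0 z.1; have := sqr_ge0 z.2.
  by move=> ? ?; split; apply: sq2; lra.
have Apos z : A z -> 0 < z.1 ^+ 2 + z.2 ^+ 2.
  by move=> /andP[+ _]; apply: lt_le_trans; rewrite divr_gt0 // exprn_gt0.
have b3 (t : R) : -2 <= t -> t <= 2 -> [/\ `|t| < 3, `|t + h| < 3 & `|t| <= 3].
  by move=> t1 t2; rewrite !ltr_norml ler_norml; split; apply/andP; split; lra.
have A1 : A (-1, 0).
  rewrite /A/= sqrrN expr1n expr0n /= addr0; apply/andP; split; last by lra.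
  by have : eta ^+ 2 <= 1; [rewrite expr_le1 // ltW|lra].
have cq : continuous (fun z : R * R => z.1 ^+ 2 + z.2 ^+ 2).
  move=> z; apply: cvgD; rewrite expr2; under eq_fun do rewrite expr2;
    by apply: cvgM; (exact: cvg_fst || exact: cvg_snd).
have cA : compact A.
  apply: (@subclosed_compact _ A (`[-2, 2] `*` `[-2, 2])%classic).
  - rewrite (_ : A = (fun z : R * R => z.1 ^+ 2 + z.2 ^+ 2) @^-1`
      (`[eta ^+ 2 / 4, 4]%classic)); last first.
      by apply/seteqP; split => z; rewrite /A/= in_itv.
    by apply: closed_comp; [move=> z _; exact: cq|exact: itv_closed].
  - by apply: compact_setX; exact: segment_compact.
  - by move=> z /Abox[z1 z2]; split; rewrite /= in_itv.
have cW : {within A, continuous W}.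
  apply: continuous_in_subspaceT => z /[!inE] Az.
  have [/andP[x1 x2] /andP[y1 y2]] := Abox z Az.
  apply: cvgB.
    apply/cvgrPdist_lt => e e0.
    have C0 : 0 <= C by apply: le_trans (uC 0 0 _ _); rewrite ?normr0.
    pose d := Num.min 4^-1 (e / (4 * (C + 1))).
    have d0 : 0 < d.
      by rewrite lt_min invr_gt0 ltr0n /= divr_gt0 // mulr_gt0 // ltr_wpDl.
    apply: filterS (nbhsx_ballx z d d0) => w [/= w1 w2].
    have [z1 z1h z1'] := b3 _ x1 x2; have [z2 _ z2'] := b3 _ y1 y2.
    move: w1 w2; rewrite /ball/= distrC [`|z.2 - _|]distrC.
    rewrite !lt_min => /andP[d1 e1] /andP[d2 e2].
    have [w1 w1h w2] : [/\ `|w.1| < 3, `|w.1 + h| < 3 & `|w.2| < 3].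
      move: d1 d2 x1 x2 y1 y2 h0 h_eta eta1; rewrite !ltr_norml.
      clear => /andP[? ?] /andP[? ?] ? ? ? ? ? ? ?.
      by split; apply/andP; split; lra.
    rewrite distrC.
    apply: le_lt_trans (row_integral_lip uvCR uC vC h0 z1 z1h z2 w1 w1h w2) _.
    apply: (@le_lt_trans _ _ (2 * (C + 1) * (`|w.1 - z.1| + `|w.2 - z.2|))).
      by rewrite ler_wpM2r ?addr_ge0 // ler_pM2l // lerDl.
    have C1 : 0 < 2 * (C + 1) by rewrite mulr_gt0 // ltr_wpDl.
    rewrite mulrC -ltr_pdivlMr //; apply: lt_le_trans (ltrD e1 e2) _.
    rewrite le_eqVlt; apply/orP; left; apply/eqP; field.
    by rewrite gt_eqF // ltr_wpDl.
  apply: cvgMr; apply: cvgB; last exact: cvg_cst.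
  apply: cvgV; first by rewrite gt_eqF // Apos.
  exact: cq.
have [[x y] Axy minW] : exists2 z : R * R, A z & forall w, A w -> W z <= W w.
  have [|z /[!inE] Az minW] := compact_EVT_min _ cA cW; first by exists (-1, 0).
  by exists z => // w Aw; apply: minW; rewrite inE.
have [/= /andP[x1 x2] /andP[y1 y2]] := Abox _ Axy.
have [bx bxh bx'] := b3 _ x1 x2; have [by_ _ by'] := b3 _ y1 y2.
suff W0 : 0 <= W (x, y).
  have := minW _ A1; move/(le_trans W0).
  rewrite /W /= sqrrN expr1n expr0n /= addr0 invr1 subr_ge0.
  by apply: le_trans; rewrite /m; lra.
have U0 z : A z -> 0 <= U z.1 z.2.
  move=> /Abox[/andP[z1 z1'] /andP[z2 z2']].
  have [a1 a2 _] := b3 _ z1 z1'; have [_ _ a3] := b3 _ z2 z2'.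
  rewrite -(mul0r h); apply: (row_integral_ge uvCR uC) => // t /andP[t1 t2].
  by apply: u0 => //; rewrite ler_norml; apply/andP; split; lra.
have [//|Wneg] := leP 0 (W (x, y)).
pose s := x ^+ 2 + y ^+ 2.
have s0 : 0 < s by exact: (Apos _ Axy).
have /andP[/= sl s4] := Axy; rewrite -/s in sl s4.
have {}sl : eta ^+ 2 / 4 < s.
  (* A segment of length [h <= eta / 2] starting on the inner circle stays in the disc of radius
     [eta], where [c <= u]; hence [U] is above the barrier there. *)
  rewrite lt_neqAle sl andbT; apply/eqP => sE; exfalso.
  suff : c * h <= U x y.
    move: Wneg; rewrite /W /= -/s -sE => W1 U1.
    have mE : m * (eta ^+ 2 / 4)^-1 = c by rewrite /m; field; rewrite gt_eqF.
    have : h * m * ((eta ^+ 2 / 4)^-1 - 4^-1) = c * h - h * m / 4.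
      by rewrite -mE; ring.
    have := mulr_gt0 h0 m0; lra.
  apply: (row_integral_ge uvCR uC) => // t /andP[t1 t2].
  apply: uc; have /andP[xl xr] : - (eta / 2) <= x <= eta / 2.
    rewrite -ler_norml -(@ler_pXn2r _ 2) ?nnegrE //; last by rewrite divr_ge0 // ltW.
    rewrite real_normK ?num_real // exprMn.
    have -> : 2^-1 ^+ 2 = 4^-1 :> R by rewrite exprVn; congr (_^-1); ring.
    by rewrite sE /s lerDl sqr_ge0.
  have -> : eta ^+ 2 = s + eta ^+ 2 * (3 / 4) by rewrite -sE; field.
  have -> : t ^+ 2 + y ^+ 2 = s + (t - x) * (t + x) by rewrite /s; ring.
  rewrite lerD2l.
  apply: (@le_trans _ _ ((eta / 2) * (3 / 2 * eta))); last first.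
    by rewrite le_eqVlt; apply/orP; left; apply/eqP; field.
  move: t1 t2 xl xr eta0 eta1 h0 h_eta; clear => t1 t2 xl xr eta0 eta1 h0 h_eta.
  have [tx|tx] := leP 0 (t + x); last first.
    apply: (@le_trans _ _ 0); first by rewrite mulr_ge0_le0 // ?subr_ge0 // ltW.
    by rewrite mulr_ge0 //; lra.
  by apply: ler_pM; lra.
have {}s4 : s < 4.
  rewrite lt_neqAle s4 andbT; apply/eqP => sE; exfalso.
  move: Wneg; rewrite /W /= -/s sE subrr mulr0 subr0.
  by rewrite ltNge (U0 _ Axy).
exfalso.
have hm := mulr_gt0 h0 m0.
(* As [s < 4], the four-point difference of 1/|z|^2 is at least t^2/16; [U] is allowed half of the
   corresponding amount. *)
have e0 : 0 < h * m / 32 by rewrite divr_gt0.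
have [r r0 Hr] := row_integral_four_point uvCR h0 bx bxh by_ e0.
(* With coordinates bounded by 2 and [t ^+ 2 <= t], a step changes [s] by at most [5 * t], so the
   neighbours stay in the annulus; moreover [8 * t ^+ 2 <= s], as [barrier_four_point] asks. *)
pose t := Num.min (r / 2) (Num.min (s / 8) (Num.min ((4 - s) / 8) ((s - eta ^+ 2 / 4) / 8))).
have t0 : 0 < t by rewrite !lt_min !divr_gt0 // subr_gt0.
have : t <= t by [].
rewrite {2}/t !le_min => /and4P[tr ts t4 tl].
have {}Hr := Hr t t0 ltac:(lra).
have t2 : t ^+ 2 <= t by rewrite expr2 ler_piMl ?ltW //; lra.
have t2p : 0 < t ^+ 2 by rewrite exprn_gt0.
have xt : - (2 * t) <= x * t <= 2 * t.
  by rewrite ler_pM2r // -mulNr ler_pM2r // x1.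
have yt : - (2 * t) <= y * t <= 2 * t.
  by rewrite ler_pM2r // -mulNr ler_pM2r // y1.
have Ast (p q : R) : p ^+ 2 + q ^+ 2 = s + t ^+ 2 + 2 * (x * t) \/
    p ^+ 2 + q ^+ 2 = s + t ^+ 2 - 2 * (x * t) \/
    p ^+ 2 + q ^+ 2 = s + t ^+ 2 + 2 * (y * t) \/
    p ^+ 2 + q ^+ 2 = s + t ^+ 2 - 2 * (y * t) -> W (x, y) <= W (p, q).
  move=> pq; apply: minW; rewrite /A/=.
  move: pq tr ts t4 tl t2 t2p xt yt; clear => pq tr ts t4 tl t2 t2p /andP[? ?] /andP[? ?].
  by apply/andP; case: pq => [->|[->|[->|->]]]; split; lra.
have w1 := Ast (x + t) y ltac:(by left; rewrite /s; ring).
have w2 := Ast (x - t) y ltac:(by right; left; rewrite /s; ring).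
have w3 := Ast x (y + t) ltac:(by do 2!right; left; rewrite /s; ring).
have w4 := Ast x (y - t) ltac:(by do 3!right; rewrite /s; ring).
have Bs : t ^+ 2 / 16 <= ((x + t) ^+ 2 + y ^+ 2)^-1 + ((x - t) ^+ 2 + y ^+ 2)^-1 +
    (x ^+ 2 + (y + t) ^+ 2)^-1 + (x ^+ 2 + (y - t) ^+ 2)^-1 - 4 / s.
  have ts8 : 8 * t ^+ 2 <= s by lra.
  apply: le_trans (barrier_four_point erefl s0 ts8).
  rewrite ler_pM2l // lef_pV2 ?posrE ?exprn_gt0 //.
  have -> : 16 = 4 ^+ 2 :> R by ring.
  by rewrite ler_pXn2r ?nnegrE ?ltW.
move: w1 w2 w3 w4 Hr Bs; rewrite /W /= -/s -/U.
set B1 := _^-1; set B2 := ((x - t) ^+ 2 + _)^-1.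
set B3 := (x ^+ 2 + (y + t) ^+ 2)^-1; set B4 := (x ^+ 2 + (y - t) ^+ 2)^-1.
move=> w1 w2 w3 w4 /ler_normlW Hr /(ler_wpM2l (ltW hm)) hB.
move: w1 w2 w3 w4 Hr hB (mulr_gt0 hm t2p).
move: (h * m) (t ^+ 2) (U _ _) (U _ _) (U _ _) (U _ _) (U _ _) B1 B2 B3 B4.
by clear => *; lra.
Qed.

End BarrierBound.

End Comparison.

(** * Harnack's inequality, by shrinking the segments to a point *)

Section Harnack.
Variable R : realType.
Implicit Types (u v : R -> R -> R).

(** Divide [row_integral_barrier] by [h]: for small [h] the mean of [u] over the segment is within
    [e] of its value at -1. In the application 0 stands for x + y and -1 for x. *)
Lemma harnack (C c eta : R) u v : 0 < c -> 0 < eta -> eta <= 1 ->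
  (forall x y, `|x| <= 3 -> `|y| <= 3 -> cauchy_riemann u v x y) ->
  (forall x y, `|x| <= 3 -> `|y| <= 3 -> `|u x y| <= C) ->
  (forall x y, `|x| <= 3 -> `|y| <= 3 -> `|v x y| <= C) ->
  (forall x y, `|x| <= 3 -> `|y| <= 3 -> 0 <= u x y) ->
  (forall x y : R, x ^+ 2 + y ^+ 2 <= eta ^+ 2 -> c <= u x y) ->
  3 * c * eta ^+ 2 / 16 <= u (-1) 0.
Proof.
move=> c0 eta0 eta1 uvCR uC vC u0 uc; apply/ler_addgt0Pl.
suff H (e : R) : 0 < e -> 3 * c * eta ^+ 2 / 16 <= e + u (-1) 0 by move=> e /H.
move=> e0.
have n1 : `|-1 : R| <= 3 by rewrite normrN normr1; lra.
have n0 : `|0 : R| <= 3 by rewrite normr0; lra.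
have [d d0 Hd] := cauchy_riemann_continuous (uvCR _ _ n1 n0) e0.
pose h := Num.min (eta / 2) (d / 2).
have h0 : 0 < h by rewrite lt_min !divr_gt0.
have : h <= h by [].
rewrite {2}/h le_min => /andP[h1 h2].
have HU := row_integral_barrier c0 eta0 eta1 h0 h1 uvCR uC vC u0 uc.
have b1 : - 3 < -1 :> R by lra.
have b2 : -1 <= -1 + h by lra.
have b3 : -1 + h < 3 by lra.
have := @primitive_affine _ 3 (u ^~ 0) (-1) (-1 + h) (u (-1) 0) 0 e
  (CR_continuous_row uvCR n0) b1 b2 b3.
rewrite !mul0r !addr0 (_ : -1 + h - -1 = h); last by ring.
rewrite -/(row_integral 3 u h (-1) 0) => /(_ _)/ler_normlW Hp.
have {}Hp : row_integral 3 u h (-1) 0 - u (-1) 0 * h <= e * h.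
  apply: Hp => t /andP[t1 t2]; rewrite mul0r addr0.
  have [||+ _] := Hd (t - -1) 0.
  - by rewrite ltr_norml; apply/andP; split; lra.
  - by rewrite normr0.
  by rewrite subrKC addr0 => /ltW.
rewrite -(ler_pM2r h0); apply: le_trans HU _.
by rewrite [leRHS]mulrDl -lerBlDr.
Qed.

End Harnack.

(** * The norm of the bidual of the renormed c_0 *)

Lemma rnorm_bounded_continuous (R : realType) (V W : normedModType R[i])
    (f : {linear V -> W}) (M : R) : 0 <= M ->
  (forall v, rnorm (f v) <= M * rnorm v) -> continuous f.
Proof.
move=> M0 fM; apply: bounded_linear_continuous; apply/bounded_funP => r.
exists (M * complex.Re r)%:C => v vr.
rewrite /= -rnormE lecR (le_trans (fM v)) // ler_wpM2l //.
by move: vr; rewrite -rnormE; case: (r) => a b; rewrite lecE /= => /andP[].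
Qed.

Section DualBasics.
Variables (R : realType) (V : normedModType R[i]).
Implicit Types (f : dual V) (v : V).

Lemma rnormM (a b : R[i]) : rnorm (a * b : R[i]) = rnorm (a : R[i]) * rnorm (b : R[i]).
Proof. exact: rnormZ. Qed.

Lemma dual_unit_le f v : unit_ball V v -> rnorm (f v) <= rnorm f.
Proof. by move=> v1; apply: supnorm_ub => //; exact: dual_bounded. Qed.

Lemma dual_norm_le f (M : R) :
  (forall v, unit_ball V v -> rnorm (f v) <= M) -> rnorm f <= M.
Proof. exact: (supnorm_le (unit_ball0 V)). Qed.

Lemma dual_le f v : rnorm (f v) <= rnorm f * rnorm v.
Proof.
have [->|v0] := eqVneq v 0.
  by rewrite -(scale0r 0) dualZ mul0r scale0r !rnorm0 mulr0.
have r0 : 0 < rnorm v.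
  by rewrite lt_neqAle rnorm_ge0 andbT; apply: contra_neq v0 => /esym/rnorm0_eq0.
rewrite -ler_pdivrMr // mulrC.
have -> : (rnorm v)^-1 = rnorm ((rnorm v)^-1%:C : R[i]).
  by rewrite rnormC ger0_norm // invr_ge0 ltW.
rewrite -rnormM -dualZ; apply/dual_unit_le/unit_ballE.
by rewrite rnormZ rnormC ger0_norm ?invr_ge0 ?rnorm_ge0 // mulVf // gt_eqF.
Qed.

Lemma dual_additive f v w : f (v + w) = f v + f w.
Proof. by have := dual_scalar f 1 v w; rewrite scale1r /= mul1r. Qed.

Lemma dual_sub f v w : f (v - w) = f v - f w.
Proof. by rewrite dual_additive -scaleN1r dualZ mulN1r. Qed.

Lemma bounded_dual_pred (f : V -> R[i]) (M : R) : 0 <= M -> scalar f ->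
  (forall v, rnorm (f v) <= M * rnorm v) -> f \in @dual_pred R V.
Proof.
move=> M0 lf fM; apply/dual_predP; split=> //.
pose F : {linear V -> R[i]} := HB.pack f (GRing.isLinear.Build _ _ _ _ _ lf).
exact: (rnorm_bounded_continuous (f := F) M0 fM).
Qed.

End DualBasics.

(** * Coordinates, truncations and weighted partial sums *)

Section Coordinates.
Variable R : realType.
Local Notation Z := (renormed_c0 R).
Implicit Types (s : nat -> R[i]) (x : Z) (Phi : dual Z) (F G : dual (dual Z)).

Lemma c0_trunc_subproof s n : (fun k => if (k < n)%N then s k else 0) \in @c0_pred R.
Proof.
rewrite inE; apply: cvg_near_cst; exists n => // k /= nk.
by rewrite ltnNge nk.
Qed.

(** Takes an arbitrary sequence, as does [wsum], since both are applied to the coordinates of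
    elements of Z'', which need not tend to zero. *)
Definition c0_trunc s n : c0 R := C0 (c0_trunc_subproof s n).

Lemma c0_truncE s n k : c0_trunc s n k = if (k < n)%N then s k else 0.
Proof. by []. Qed.

Definition c0_basis n : c0 R := c0_trunc (fun k => (k == n)%:R) n.+1.

Lemma c0_basisE n k : c0_basis n k = (k == n)%:R.
Proof. by rewrite c0_truncE ltnS; case: ltngtP. Qed.

Lemma c0_addE (x y : c0 R) k : (x + y) k = x k + y k. Proof. by []. Qed.
Lemma c0_oppE (x : c0 R) k : (- x) k = - x k. Proof. by []. Qed.
Lemma c0_scaleE (a : R[i]) (x : c0 R) k : (a *: x) k = a * x k. Proof. by []. Qed.
Lemma c0P (x y : c0 R) : (forall k, x k = y k) -> x = y.
Proof. by move=> xy; apply/val_inj/funext. Qed.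

Lemma c0_trunc0 s : c0_trunc s 0 = 0.
Proof. by apply: c0P. Qed.

Lemma c0_truncS s n : c0_trunc s n.+1 = c0_trunc s n + s n *: c0_basis n.
Proof.
apply: c0P => k; rewrite c0_addE c0_scaleE c0_basisE !c0_truncE ltnS.
by case: ltngtP => [||->]; rewrite ?(mulr0, mulr1, addr0, add0r).
Qed.

Lemma c0_truncD s t n : c0_trunc (fun k => s k + t k) n = c0_trunc s n + c0_trunc t n.
Proof. by apply: c0P => k; rewrite c0_addE !c0_truncE; case: ifP; rewrite ?addr0. Qed.

Lemma c0_le x k : rnorm (x k) <= supnorm setT x.
Proof. by apply: supnorm_ub => //; exact: c0_bounded. Qed.

Lemma rnorm_renormed x : rnorm x = supnorm setT x + l2w x.
Proof. by []. Qed.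

Lemma coord_le_rnorm x k : rnorm (x k) <= rnorm x.
Proof. by rewrite rnorm_renormed (le_trans (c0_le x k)) // lerDl l2w_ge0. Qed.

Lemma rnorm_le2 x : rnorm x <= 2 * supnorm setT x.
Proof. by rewrite rnorm_renormed mulr_natl mulr2n lerD2l l2w_le. Qed.

Lemma c0_coord_subproof n : (fun x : Z => x n) \in @dual_pred R Z.
Proof.
apply: (@bounded_dual_pred _ _ _ 1) => // x.
by rewrite mul1r coord_le_rnorm.
Qed.

Definition c0_coord n : dual Z := Dual (c0_coord_subproof n).

Lemma c0_coord_le1 n : rnorm (c0_coord n) <= 1.
Proof. by apply: dual_norm_le => x /unit_ballE; apply: le_trans (coord_le_rnorm x n). Qed.

Lemma dual_trunc Phi s n : Phi (c0_trunc s n : Z) = \sum_(i < n) s i * Phi (c0_basis i : Z).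
Proof.
elim: n => [|n IH]; first by rewrite big_ord0 c0_trunc0 -(scale0r (0 : Z)) dualZ mul0r.
by rewrite big_ord_recr /= -IH c0_truncS -dualZ -dual_additive.
Qed.

Lemma bidual_comb F (b : nat -> R[i]) n :
  F (\sum_(i < n) b i *: c0_coord i) = \sum_(i < n) b i * F (c0_coord i).
Proof.
elim: n => [|n IH]; first by rewrite !big_ord0 -(scale0r (0 : dual Z)) dualZ mul0r.
by rewrite !big_ord_recr /= -IH dual_additive dualZ.
Qed.

Lemma comb_coordE (b : nat -> R[i]) n x :
  (\sum_(i < n) b i *: c0_coord i) x = \sum_(i < n) b i * x i.
Proof.
elim: n => [|n IH]; first by rewrite !big_ord0.
rewrite !big_ord_recr /= -IH.
by [].
Qed.

Definition wsum s n : R := series (fun i => rnorm (s i / 2 ^+ i.+1) ^+ 2) n.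

Lemma wsumS s n : wsum s n.+1 = wsum s n + rnorm (s n / 2 ^+ n.+1) ^+ 2.
Proof. by rewrite /wsum seriesSr. Qed.

Lemma wsum0 s : wsum s 0 = 0.
Proof. by rewrite /wsum /series /= big_geq. Qed.

Lemma wsum_ge0 s n : 0 <= wsum s n.
Proof. by apply: sumr_ge0 => i _; exact: sqr_ge0. Qed.

Lemma wsum_homo s m n : (m <= n)%N -> wsum s m <= wsum s n.
Proof.
move: m n; apply/nondecreasing_seqP => k.
by rewrite wsumS lerDl sqr_ge0.
Qed.

Lemma wsum_trunc s n m : (n <= m)%N -> wsum (c0_trunc s n) m = wsum s n.
Proof.
elim: m => [|m IH]; first by rewrite leqn0 => /eqP ->; rewrite !wsum0.
rewrite leq_eqVlt => /predU1P[->|nm].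
  by apply: eq_big_nat => i /andP[_ im]; rewrite c0_truncE im.
rewrite ltnS in nm.
by rewrite wsumS IH // c0_truncE ltnNge nm /= mul0r rnorm0 expr0n /= addr0.
Qed.

Lemma l2w_trunc s n : l2w (c0_trunc s n) = Num.sqrt (wsum s n).
Proof.
rewrite /l2w; congr Num.sqrt; apply: lim_near_cst => //.
by exists n => // m /= nm; exact: (wsum_trunc s nm).
Qed.

Lemma wsumD_sqrt s t n : Num.sqrt (wsum (fun k => s k + t k) n) <=
  Num.sqrt (wsum s n) + Num.sqrt (wsum t n).
Proof. by rewrite -!l2w_trunc c0_truncD l2wD. Qed.

Lemma wsum_le_l2w x n : Num.sqrt (wsum x n) <= l2w x.
Proof. exact: l2w_series_le. Qed.

Lemma rnorm_trunc s n (B : R) : 0 <= B -> (forall k, rnorm (s k) <= B) ->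
  rnorm (c0_trunc s n : Z) <= B + Num.sqrt (wsum s n).
Proof.
move=> B0 sB; rewrite rnorm_renormed l2w_trunc lerD2r.
apply: (@supnorm_le _ _ _ _ 0%N) => // k _.
by rewrite c0_truncE; case: ifP => // _; rewrite rnorm0.
Qed.

End Coordinates.

(** * The norm of Z'' in terms of coordinates *)

Section BidualNorm.
Variable R : realType.
Local Notation Z := (renormed_c0 R).
Implicit Types (s t : nat -> R[i]) (x : Z) (Phi : dual Z) (F G : dual (dual Z)).

Lemma phase (z : R[i]) :
  exists th : R[i], rnorm (th : R[i]) <= 1 /\ th * z = (rnorm (z : R[i]))%:C.
Proof.
have [->|z0] := eqVneq z 0; first by exists 0; rewrite mulr0 !rnorm0.
exists ((rnorm (z : R[i]))%:C / z); rewrite divfK //; split => //.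
have : rnorm ((rnorm (z : R[i]))%:C / z * z : R[i]) = rnorm (z : R[i]).
  by rewrite divfK // rnormC ger0_norm ?rnorm_ge0.
rewrite rnormM => /(canRL (mulfK _)) ->; first by rewrite divff //; apply: contra_neq z0 => /rnorm0_eq0.
by apply: contra_neq z0 => /rnorm0_eq0.
Qed.

Lemma phases s : exists th : nat -> R[i], forall i,
  rnorm (th i : R[i]) <= 1 /\ th i * s i = (rnorm (s i : R[i]))%:C.
Proof. by have [th Hth] := choice (fun i => phase (s i)); exists th. Qed.

Lemma wsum_cauchy_schwarz s t n :
  \sum_(i < n) rnorm (s i / 2 ^+ i.+1) * rnorm (t i / 2 ^+ i.+1) <=
  Num.sqrt (wsum s n) * Num.sqrt (wsum t n).
Proof.
elim: n => [|n IH]; first by rewrite big_ord0 mulr_ge0 // sqrtr_ge0.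
rewrite big_ord_recr /= !wsumS.
set f := rnorm (s n / _); set g := rnorm (t n / _).
have f0 : 0 <= f by exact: rnorm_ge0.
have g0 : 0 <= g by exact: rnorm_ge0.
set p := Num.sqrt (wsum s n); set q := Num.sqrt (wsum t n).
have p0 : 0 <= p by exact: sqrtr_ge0.
have q0 : 0 <= q by exact: sqrtr_ge0.
have pE : wsum s n = p ^+ 2 by rewrite sqr_sqrtr // wsum_ge0.
have qE : wsum t n = q ^+ 2 by rewrite sqr_sqrtr // wsum_ge0.
apply: (@le_trans _ _ (p * q + f * g)); first by rewrite lerD2r.
rewrite pE qE -[leRHS]sqrtrM; last by rewrite addr_ge0 // sqr_ge0.
rewrite -[leLHS]ger0_norm ?addr_ge0 ?mulr_ge0 // -sqrtr_sqr ler_wsqrtr //.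
rewrite -subr_ge0.
have -> : (p ^+ 2 + f ^+ 2) * (q ^+ 2 + g ^+ 2) - (p * q + f * g) ^+ 2 =
  (p * g - q * f) ^+ 2 by ring.
exact: sqr_ge0.
Qed.

Lemma rnorm_sum n (f : 'I_n -> R[i]) :
  rnorm (\sum_(i < n) f i : R[i]) <= \sum_(i < n) rnorm (f i : R[i]).
Proof.
elim/big_ind2: _ => [|a b c d ab cd|//]; first by rewrite rnorm0.
by apply: le_trans (rnormD _ _) _; exact: lerD.
Qed.

(** [F] is evaluated at [Psi], the sum of a rotated coordinate functional and of the functional
    giving equality in Cauchy-Schwarz for the weighted sum. The two parts are dominated by the two
    terms of the norm of Z, so [Psi] has norm at most 1. *)
Lemma bidual_ge F k n :
  rnorm (F (c0_coord R k)) + Num.sqrt (wsum (fun i => F (c0_coord R i)) n) <= rnorm F.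
Proof.
set s := fun i => F (c0_coord R i); set a := Num.sqrt _.
have [th Hth] := phases s.
have a0 : 0 <= a by exact: sqrtr_ge0.
(* If [a = 0], division by zero yields [r i = 0] and the second part of [Psi] vanishes, as it
   should. *)
pose r i : R := rnorm (s i : R[i]) / 2 ^+ i.+1 / 2 ^+ i.+1 / a.
have r0 i : 0 <= r i by rewrite !divr_ge0 ?rnorm_ge0 // exprn_ge0.
pose b i := th i * (r i)%:C.
pose Psi := th k *: c0_coord R k + \sum_(i < n) b i *: c0_coord R i.
have FPsi : F Psi = (rnorm (s k : R[i]) + a)%:C.
  rewrite dual_additive dualZ bidual_comb -/(s k) (Hth k).2 rmorphD /=; congr (_ + _).
  have -> : a = wsum s n / a.
    have [->|aN0] := eqVneq a 0; first by rewrite invr0 mulr0.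
    by apply: (canRL (mulfK aN0)); rewrite -expr2 sqr_sqrtr // wsum_ge0.
  rewrite /wsum /series /= big_mkord mulr_suml rmorph_sum; apply: eq_bigr => i _.
  rewrite -/(s i) /b mulrAC (Hth i).2 -rmorphM; congr (_%:C).
  by rewrite rnorm_scale /r expr2; ring.
have Psi1 : rnorm Psi <= 1.
  apply: dual_norm_le => x /unit_ballE x1; apply: le_trans x1.
  have -> : Psi x = th k * x k + \sum_(i < n) b i * x i.
    by rewrite -comb_coordE.
  apply: le_trans (rnormD _ _) _; rewrite rnorm_renormed; apply: lerD.
    rewrite rnormM; apply: le_trans (c0_le x k).
    by rewrite ler_piMl ?rnorm_ge0 // (Hth k).1.
  apply: le_trans (wsum_le_l2w x n); apply: le_trans (rnorm_sum _) _.
  apply: (@le_trans _ _ ((\sum_(i < n) rnorm (s i / 2 ^+ i.+1) * rnorm (x i / 2 ^+ i.+1)) / a)).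
    rewrite mulr_suml; apply: ler_sum => i _; rewrite !rnorm_scale /b !rnormM rnormC ger0_norm //.
    rewrite -[leLHS]mulrA.
    apply: (@le_trans _ _ (r i * rnorm (x i : R[i]))).
      by rewrite ler_piMl ?(Hth i).1 // mulr_ge0 // rnorm_ge0.
    by rewrite le_eqVlt; apply/orP; left; apply/eqP; rewrite /r; ring.
  have [->|aN0] := eqVneq a 0; first by rewrite invr0 mulr0 sqrtr_ge0.
  rewrite ler_pdivrMr ?lt_neqAle ?a0 1?eq_sym ?aN0 // mulrC.
  exact: wsum_cauchy_schwarz.
have := dual_le F Psi; rewrite FPsi rnormC ger0_norm ?addr_ge0 ?rnorm_ge0 //.
by move=> /le_trans; apply; rewrite ler_piMr // rnorm_ge0.
Qed.

Lemma c0_approx x (e : R) : 0 < e -> exists n0, forall n, (n0 <= n)%N ->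
  rnorm (x - (c0_trunc x n : Z)) <= e.
Proof.
move=> e0; have /cvgrPdist_lt := c0_cvg x => /(_ (e / 2)%:C).
rewrite ltcR divr_gt0 // => /(_ isT)[n0 _ Hn]; exists n0 => n n0n.
apply: le_trans (rnorm_le2 _) _.
rewrite mulrC -ler_pdivlMr //; apply: (@supnorm_le _ _ _ _ 0%N) => // k _.
rewrite c0_addE c0_oppE c0_truncE; case: ltnP => [kn|nk].
  by rewrite subrr rnorm0 divr_ge0 // ltW.
have /= := Hn k (leq_trans n0n nk); rewrite sub0r normrN -rnormE ltcR subr0.
exact: ltW.
Qed.

(** Testing [Phi] on truncated sequences of phases, of norm at most 2, bounds the sum of the moduli
    of its coefficients. So [Phi] is given by a summable sequence, whose tails are small. *)
Lemma dual_tail Phi (e : R) : 0 < e -> exists n,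
  rnorm (Phi - \sum_(i < n) Phi (c0_basis R i : Z) *: c0_coord R i) <= e.
Proof.
move=> e0; pose T m := \sum_(i < m) rnorm (Phi (c0_basis R i : Z)).
have [th Hth] := phases (fun i => Phi (c0_basis R i : Z)).
have T2 m : T m <= rnorm Phi * 2.
  have : rnorm (Phi (c0_trunc th m : Z)) <= rnorm Phi * 2.
    apply: le_trans (dual_le _ _) _; rewrite ler_wpM2l ?rnorm_ge0 //.
    apply: le_trans (rnorm_le2 _) _; rewrite ler_piMr //.
    apply: (@supnorm_le _ _ _ _ 0%N) => // k _.
    by rewrite c0_truncE; case: ifP => _; [exact: (Hth k).1|rewrite rnorm0].
  rewrite dual_trunc (eq_bigr (fun i : 'I_m => (rnorm (Phi (c0_basis R i : Z)))%:C)).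
    by rewrite -rmorph_sum rnormC; apply: le_trans; exact: ler_norm.
  by move=> i _; exact: (Hth i).2.
have supT : has_sup (range T).
  by split; [exists (T 0), 0|exists (rnorm Phi * 2) => _ [m _ <-]].
have [_ [n _ <-] Tn] := sup_adherent e0 supT; exists n.
set Psi := \sum_(i < n) _.
apply: dual_norm_le => x /unit_ballE x1.
(* On truncations [Phi - Psi] sees only the coefficients from [n] on, each paired with an entry of
   modulus at most 1. *)
have D m : (n <= m)%N -> rnorm ((Phi - Psi) (c0_trunc x m : Z)) <= T m - T n.
  elim: m => [|m IH].
    rewrite leqn0 => /eqP n0; rewrite n0 subrr c0_trunc0.
    by rewrite -(scale0r (0 : Z)) dualZ mul0r rnorm0.
  rewrite leq_eqVlt => /predU1P[<-|nm].
    have -> : (Phi - Psi) (c0_trunc x n : Z) = 0.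
      have -> : (Phi - Psi) (c0_trunc x n : Z) = Phi (c0_trunc x n : Z) - Psi (c0_trunc x n : Z) by [].
      rewrite dual_trunc /Psi (comb_coordE (fun i => Phi (c0_basis R i : Z))); apply/eqP; rewrite subr_eq0; apply/eqP.
      by apply: eq_bigr => i _; rewrite c0_truncE ltn_ord mulrC.
    by rewrite rnorm0 subrr.
  rewrite ltnS in nm; rewrite c0_truncS dual_additive dualZ.
  apply: le_trans (rnormD _ _) _.
  rewrite /T big_ord_recr /= addrAC; apply: lerD; first exact: IH.
  rewrite rnormM [X in _ * rnorm X](_ : _ = Phi (c0_basis R m : Z)); last first.
    rewrite -[RHS]subr0; congr (_ - _).
    rewrite /Psi (comb_coordE (fun i => Phi (c0_basis R i : Z))) big1 // => i _.
    by rewrite c0_basisE ltn_eqF ?mulr0 // (leq_trans (ltn_ord i)).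
  rewrite ler_piMl ?rnorm_ge0 //.
  exact: le_trans (coord_le_rnorm x m) x1.
apply/ler_addgt0Pl => d d0.
have d'0 : 0 < d / (rnorm (Phi - Psi) + 1).
  by rewrite divr_gt0 // ltr_wpDl // rnorm_ge0.
have [m0 Hm] := c0_approx x d'0.
have := Hm _ (leq_maxr n m0); have {}D := D _ (leq_maxl n m0).
set m := maxn n m0 in D *; move=> Hx.
have xE : x = (x - (c0_trunc x m : Z)) + (c0_trunc x m : Z) by rewrite subrK.
rewrite xE dual_additive.
apply: le_trans (rnormD _ _) _; apply: lerD; last first.
  apply: (le_trans D).
  have : T m <= sup (range T) by apply: ub_le_sup; [case: supT|exists m].
  lra.
apply: le_trans (dual_le _ _) _; apply: le_trans (ler_wpM2l (rnorm_ge0 _) Hx) _.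
rewrite mulrCA ler_piMr ?(ltW d0) // ler_pdivrMr ?ltr_wpDl ?rnorm_ge0 //.
by rewrite mul1r lerDl.
Qed.

(** By [dual_tail] it suffices to evaluate [F] at a finite combination [Psi] of coordinates, and
    [F Psi] is the value of [Phi] at the truncated coordinate sequence of [F]. *)
Lemma bidual_le F (B : R) :
  (forall n, rnorm (c0_trunc (fun i => F (c0_coord R i)) n : Z) <= B) -> rnorm F <= B.
Proof.
move=> FB; apply: dual_norm_le => Phi /unit_ballE Phi1.
apply/ler_addgt0Pl => e e0.
have e'0 : 0 < e / (rnorm F + 1) by rewrite divr_gt0 // ltr_wpDl // rnorm_ge0.
have [n Hn] := dual_tail Phi e'0; set Psi := \sum_(i < n) _ in Hn.
rewrite -[X in F X](subrK Psi) dual_additive.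
apply: le_trans (rnormD _ _) _; apply: lerD.
  apply: le_trans (dual_le _ _) _; apply: le_trans (ler_wpM2l (rnorm_ge0 _) Hn) _.
  rewrite mulrCA ler_piMr ?(ltW e0) // ler_pdivrMr ?ltr_wpDl ?rnorm_ge0 //.
  by rewrite mul1r lerDl.
have -> : F Psi = Phi (c0_trunc (fun i => F (c0_coord R i)) n : Z).
  by rewrite dual_trunc (bidual_comb F (fun i => Phi (c0_basis R i : Z))); apply: eq_bigr => i _; rewrite mulrC.
apply: le_trans (dual_le _ _) _; apply: le_trans (FB n).
by rewrite ler_piMl // rnorm_ge0.
Qed.

End BidualNorm.

(** * Strict convexity of the norm of Z'' *)

Section StrictConvexity.
Variable R : realType.
Local Notation Z := (renormed_c0 R).
Implicit Types (f g : nat -> R[i]) (F G : dual (dual Z)).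

Lemma sup_range_ub (h : nat -> R) (B : R) i : (forall j, h j <= B) -> h i <= sup (range h).
Proof. by move=> hB; apply: ub_le_sup; [exists B => _ [j _ <-]|exists i]. Qed.

Lemma sup_range_le (h : nat -> R) (B : R) : (forall j, h j <= B) -> sup (range h) <= B.
Proof. by move=> hB; apply: ge_sup; [exists (h 0), 0|move=> _ [j _ <-]]. Qed.

Lemma rnorm_sqr (z : R[i]) :
  rnorm (z : R[i]) ^+ 2 = complex.Re z ^+ 2 + complex.Im z ^+ 2.
Proof.
case: z => a b; rewrite /rnorm normc_def /= sqr_sqrtr //.
by rewrite addr_ge0 // sqr_ge0.
Qed.

(* Stewart's identity, which turns near equality in Minkowski's inequality
   into near proportionality. *)
Lemma wsum_stewart f g (a b : R) n :
  wsum (fun i => b%:C * f i - a%:C * g i) n + a * b * wsum (fun i => f i + g i) n =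
  (a + b) * (b * wsum f n + a * wsum g n).
Proof.
elim: n => [|n IH]; first by rewrite !wsum0 !mulr0 !addr0 mulr0.
rewrite !wsumS !rnorm_scale !exprMn !mulrDr addrACA IH.
have key : rnorm (b%:C * f n - a%:C * g n : R[i]) ^+ 2 +
    a * b * rnorm (f n + g n : R[i]) ^+ 2 =
    (a + b) * (b * rnorm (f n : R[i]) ^+ 2 + a * rnorm (g n : R[i]) ^+ 2).
  rewrite !rnorm_sqr; case: (f n) => p q; case: (g n) => r s /=; ring.
rewrite [X in _ + X](_ : _ = (rnorm (b%:C * f n - a%:C * g n : R[i]) ^+ 2 +
    a * b * rnorm (f n + g n : R[i]) ^+ 2) * (2 ^+ n.+1)^-1 ^+ 2); last by ring.
rewrite key; ring.
Qed.

(** Since sF + a <= M, sG + b <= M, |F + G| <= sF + sG + A and A <= a + b, the hypotheses force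
    equality throughout. Equality in the weighted part makes the coordinate sequences proportional,
    and the supremum part fixes the ratio. *)
Lemma bidual_strict_convex F G (M : R) : rnorm F <= M -> rnorm G <= M ->
  2 * M <= rnorm (F + G) -> forall i, F (c0_coord R i) = G (c0_coord R i).
Proof.
move=> FM GM FGM.
have [Mz|MN0] := eqVneq M 0.
  have F0 : F = 0 by apply: rnorm0_eq0; apply/eqP; rewrite eq_le rnorm_ge0 -Mz FM.
  have G0 : G = 0 by apply: rnorm0_eq0; apply/eqP; rewrite eq_le rnorm_ge0 -Mz GM.
  by rewrite F0 G0.
have M0 : 0 < M by rewrite lt_neqAle eq_sym MN0 (le_trans (rnorm_ge0 F)).

pose f i := F (c0_coord R i); pose g i := G (c0_coord R i).
pose sF := sup (range (fun i => rnorm (f i : R[i]))).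
pose sG := sup (range (fun i => rnorm (g i : R[i]))).
pose a := sup (range (fun n => Num.sqrt (wsum f n))).
pose b := sup (range (fun n => Num.sqrt (wsum g n))).
pose A := sup (range (fun n => Num.sqrt (wsum (fun i => f i + g i) n))).
have fM k n : rnorm (f k : R[i]) + Num.sqrt (wsum f n) <= M.
  exact: le_trans (bidual_ge F k n) FM.
have gM k n : rnorm (g k : R[i]) + Num.sqrt (wsum g n) <= M.
  exact: le_trans (bidual_ge G k n) GM.
have fk k : rnorm (f k : R[i]) <= M.
  by apply: le_trans (fM k 0); rewrite lerDl sqrtr_ge0.
have gk k : rnorm (g k : R[i]) <= M.
  by apply: le_trans (gM k 0); rewrite lerDl sqrtr_ge0.
have fn n : Num.sqrt (wsum f n) <= M.
  by apply: le_trans (fM 0 n); rewrite lerDr rnorm_ge0.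
have gn n : Num.sqrt (wsum g n) <= M.
  by apply: le_trans (gM 0 n); rewrite lerDr rnorm_ge0.
have sFk k : rnorm (f k : R[i]) <= sF := sup_range_ub k fk.
have sGk k : rnorm (g k : R[i]) <= sG := sup_range_ub k gk.
have an n : Num.sqrt (wsum f n) <= a := sup_range_ub n fn.
have bn n : Num.sqrt (wsum g n) <= b := sup_range_ub n gn.
have hn n : Num.sqrt (wsum (fun i => f i + g i) n) <= a + b.
  by apply: le_trans (wsumD_sqrt f g n) _; exact: lerD.
have An n : Num.sqrt (wsum (fun i => f i + g i) n) <= A := sup_range_ub n hn.
have Aab : A <= a + b := sup_range_le hn.
(* In [fM] the indices [k] and [n] are independent, so the two suprema may be taken one after the
   other. *)
have sFa : sF + a <= M.
  rewrite -lerBrDr; apply: sup_range_le => k; rewrite lerBrDr addrC -lerBrDr.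
  by apply: sup_range_le => n; rewrite lerBrDr addrC.
have sGb : sG + b <= M.
  rewrite -lerBrDr; apply: sup_range_le => k; rewrite lerBrDr addrC -lerBrDr.
  by apply: sup_range_le => n; rewrite lerBrDr addrC.
have sF0 : 0 <= sF := le_trans (rnorm_ge0 _) (sFk 0).
have sG0 : 0 <= sG := le_trans (rnorm_ge0 _) (sGk 0).
have a0 : 0 <= a := le_trans (sqrtr_ge0 _) (an 0).
have b0 : 0 <= b := le_trans (sqrtr_ge0 _) (bn 0).
have FGA : rnorm (F + G) <= sF + sG + A.
  apply: bidual_le => n.
  apply: (@le_trans _ _ (sF + sG + Num.sqrt (wsum (fun i => f i + g i) n))); last first.
    by rewrite lerD2l.
  apply: rnorm_trunc => [|k]; first exact: addr_ge0.
  by apply: le_trans (rnormD (f k) (g k)) _; apply: lerD; [exact: sFk|exact: sGk].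
have [MF MG abA] : [/\ sF + a = M, sG + b = M & A = a + b].
  by split; apply/eqP; rewrite eq_le; apply/andP; split; lra.
have wfa n : wsum f n <= a ^+ 2.
  by rewrite -[leLHS]sqr_sqrtr ?wsum_ge0 // ler_pXn2r ?nnegrE ?sqrtr_ge0 // an.
have wgb n : wsum g n <= b ^+ 2.
  by rewrite -[leLHS]sqr_sqrtr ?wsum_ge0 // ler_pXn2r ?nnegrE ?sqrtr_ge0 // bn.
have prop i : b%:C * f i = a%:C * g i.
  apply/eqP; rewrite -subr_eq0; apply/eqP/rnorm0_eq0.
  apply/eqP; rewrite -sqrf_eq0 eq_le sqr_ge0 andbT.
  pose w : R := (2 ^+ i.+1) ^+ 2.
  have w0 : 0 < w by rewrite !exprn_gt0.
  suff H (e : R) : 0 < e -> rnorm (b%:C * f i - a%:C * g i : R[i]) ^+ 2 / w <=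
      a * b * (2 * (a + b)) * e.
    apply/ler_addgt0Pl.
    suff H' (e : R) : 0 < e -> rnorm (b%:C * f i - a%:C * g i : R[i]) ^+ 2 <= e.
      by move=> e /H'; rewrite addr0.
    move=> e0; set K := a * b * (2 * (a + b)) in H.
    have K0 : 0 <= K by rewrite !mulr_ge0 // addr_ge0.
    have wK : 0 < w * (K + 1) by rewrite mulr_gt0 // ltr_wpDl.
    have := H (e / (w * (K + 1))) (divr_gt0 e0 wK).
    rewrite ler_pdivrMr // => /le_trans; apply.
    rewrite (_ : K * (e / (w * (K + 1))) * w = e * (K / (K + 1))); last first.
      by field; rewrite !gt_eqF // ltr_wpDl.
    by rewrite ler_piMr ?(ltW e0) // ler_pdivrMr ?ltr_wpDl // mul1r lerDl.
  move=> e0.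
  have hasA : has_sup (range (fun n => Num.sqrt (wsum (fun i => f i + g i) n))).
    by split; [exists (Num.sqrt (wsum (fun i => f i + g i) 0)), 0|exists (a + b) => _ [j _ <-]].
  have [_ [n0 _ <-]] := sup_adherent e0 hasA; rewrite -/A abA => An0.
  (* [n0] makes the partial sum of [F + G] nearly maximal, and [i.+1] makes the sums include the
     term of index [i]. *)
  pose n := maxn n0 i.+1.
  have St := wsum_stewart f g a b n.
  have q1 : rnorm (b%:C * f i - a%:C * g i : R[i]) ^+ 2 / w <=
      wsum (fun i => b%:C * f i - a%:C * g i) n.
    apply: le_trans (wsum_homo _ (leq_maxr n0 i.+1)).
    by rewrite wsumS rnorm_scale exprMn exprVn lerDr wsum_ge0.
  apply: le_trans q1 _.
  have q2 : (a + b) ^+ 2 - wsum (fun i => f i + g i) n <= 2 * (a + b) * e.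
    apply: le_trans (lerB (lexx _) (wsum_homo _ (leq_maxl n0 i.+1))) _.
    move: (hn n0) An0 (wsum_ge0 (fun i => f i + g i) n0).
    set W := wsum _ n0 => h1 h2 W0.
    have -> : W = Num.sqrt W ^+ 2 by rewrite sqr_sqrtr.
    have r0 := sqrtr_ge0 W; rewrite subr_sqr mulrC; apply: ler_pM; lra.
  have abn := mulr_ge0 a0 b0.
  have q3 : (a + b) * (b * wsum f n + a * wsum g n) <= a * b * (a + b) ^+ 2.
    rewrite (_ : a * b * (a + b) ^+ 2 = (a + b) * (b * a ^+ 2 + a * b ^+ 2)); last by ring.
    by apply: ler_wpM2l; [exact: addr_ge0|apply: lerD; exact: ler_wpM2l].
  have := ler_wpM2l abn q2; lra.
(* Proportionality passes to the suprema as b sF = a sG. Adding a b to both sides and using sF + a =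
   sG + b = M gives b M = a M. *)
have ab : a = b.
  suff H : M * b = M * a by apply/esym; apply: (mulfI _ H); rewrite gt_eqF.
  have nprop i : b * rnorm (f i : R[i]) = a * rnorm (g i : R[i]).
    have := congr1 (fun z : R[i] => rnorm (z : R[i])) (prop i).
    by rewrite !rnormM !rnormC !ger0_norm.
  have H1 : b * sF <= a * sG.
    have [->|bN0] := eqVneq b 0; first by rewrite mul0r mulr_ge0.
    have bp : 0 < b by rewrite lt_neqAle eq_sym bN0.
    rewrite mulrC -ler_pdivlMr //; apply: sup_range_le => k.
    by rewrite ler_pdivlMr // mulrC nprop ler_wpM2l.
  have H2 : a * sG <= b * sF.
    have [->|aN0] := eqVneq a 0; first by rewrite mul0r mulr_ge0.
    have ap : 0 < a by rewrite lt_neqAle eq_sym aN0.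
    rewrite mulrC -ler_pdivlMr //; apply: sup_range_le => k.
    by rewrite ler_pdivlMr // mulrC -nprop ler_wpM2l.
  have H3 : b * sF = a * sG by apply/eqP; rewrite eq_le H1 H2.
  rewrite -{1}MF -MG; rewrite !mulrDl [sF * b]mulrC H3; ring.
(* If [a] and [b] vanish, proportionality says nothing, but then so do all weighted sums, and both
   coordinates are zero. *)
move=> i; have [az|aN0] := eqVneq a 0; last first.
  by apply: (mulfI (_ : a%:C != 0)); [rewrite fmorph_eq0|rewrite {1}ab prop].
have zero h n : wsum h n.+1 <= 0 -> h n = 0 :> R[i].
  move=> h0; apply: rnorm0_eq0; apply/eqP; rewrite -sqrf_eq0 eq_le sqr_ge0 andbT.
  have : rnorm (h n / 2 ^+ n.+1) ^+ 2 <= 0.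
    by apply: le_trans h0; rewrite wsumS lerDr wsum_ge0.
  by rewrite rnorm_scale exprMn pmulr_lle0 // exprn_gt0 // invr_gt0 exprn_gt0.
rewrite -/(f i) -/(g i) !zero //.
  by apply: le_trans (wgb _) _; rewrite -ab az expr0n.
by apply: le_trans (wfa _) _; rewrite az expr0n.
Qed.

End StrictConvexity.

(** * The canonical embedding and almost norming vectors *)

Section BidualEval.
Variables (R : realType) (V : normedModType R[i]).

Lemma bidual_eval_subproof (v : V) :
  (fun Phi : dual V => Phi v) \in @dual_pred R (dual V).
Proof.
apply: (@bounded_dual_pred _ _ _ (rnorm v)) => [||Phi]; first exact: rnorm_ge0.
  by [].
by rewrite mulrC; exact: dual_le.
Qed.

Definition bidual_eval (v : V) : dual (dual V) := Dual (bidual_eval_subproof v).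

Lemma bidual_eval_linear : linear bidual_eval.
Proof.
move=> a v w; apply/val_inj/funext => Phi /=.
by rewrite dual_additive dualZ.
Qed.

HB.instance Definition _ :=
  GRing.isLinear.Build _ _ _ _ bidual_eval bidual_eval_linear.

Lemma bidual_eval_le (v : V) : rnorm (bidual_eval v) <= rnorm v.
Proof.
apply: dual_norm_le => Phi /unit_ballE Phi1; apply: le_trans (dual_le Phi v) _.
by rewrite ler_piMl // rnorm_ge0.
Qed.

Lemma norming (Phi : dual V) (e : R) : 0 < e ->
  exists2 v, unit_ball V v & rnorm Phi - e <= complex.Re (Phi v).
Proof.
move=> e0.
have sP : has_sup [set rnorm (Phi v) | v in unit_ball V].
  split; first by exists (rnorm (Phi 0)), 0 => //; exact: unit_ball0.
  by exists (rnorm Phi) => _ [v v1 <-]; exact: dual_unit_le.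
have [_ [v v1 <-] vP] := sup_adherent e0 sP.
have [th [th1 thE]] := phase (Phi v).
exists (th *: v); last by rewrite dualZ thE /=; exact: ltW.
apply/unit_ballE; rewrite rnormZ mulr_ile1 ?rnorm_ge0 //.
exact/unit_ballE.
Qed.

End BidualEval.

Section ComplexPlane.
Variable R : realType.
Implicit Type z : R[i].

Lemma Re_le_rnorm z : `|complex.Re z| <= rnorm (z : R[i]).
Proof.
rewrite -(@ler_pXn2r _ 2) ?nnegrE ?rnorm_ge0 // real_normK ?num_real //.
by rewrite rnorm_sqr lerDl sqr_ge0.
Qed.

Lemma Im_le_rnorm z : `|complex.Im z| <= rnorm (z : R[i]).
Proof.
rewrite -(@ler_pXn2r _ 2) ?nnegrE ?rnorm_ge0 // real_normK ?num_real //.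
by rewrite rnorm_sqr lerDr sqr_ge0.
Qed.

Lemma rnorm_complex_le (s t : R) : rnorm (s +i* t : R[i]) <= `|s| + `|t|.
Proof.
rewrite -(@ler_pXn2r _ 2) ?nnegrE ?rnorm_ge0 ?addr_ge0 //.
rewrite rnorm_sqr /= sqrrD !real_normK ?num_real // -addrA [_ *+ 2 + _]addrC addrA.
by rewrite lerDl mulrn_wge0 // mulr_ge0.
Qed.

End ComplexPlane.

(** * From Frechet differentiability to the Cauchy-Riemann equations *)

Section Differentials.
Variables (R : realType) (X Y : normedModType R[i]).

(** Stated locally because elements of [Au] vanish outside the closed ball, so that the inclusion
    agrees with a linear map only near interior points. *)
Lemma near_linear_differentiable (f : X -> Y) (l : {linear X -> Y}) (x : X) :
  continuous l -> (\forall y \near x, f y = l y) -> differentiable f x.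
Proof.
move=> cl fl; have fx : f x = l x := nbhs_singleton fl.
have fo : f \o shift x = cst (f x) + l +o_ 0 id.
  apply/eqaddoP => e e0; move: fl; rewrite (near_shift 0).
  apply: filter_app; near=> h; rewrite /= subr0 => fh.
  have -> : (f \o shift x - (cst (f x) + l)) h = f (h + x) - (f x + l h) by [].
  rewrite fh fx linearD [l x + _]addrC subrr normr0.
  by rewrite mulr_ge0 // ltW.
apply/diff_locallyP; rewrite (diff_unique cl fo); split => //.
Unshelve. all: by end_near. Qed.

Lemma differentiable_expansion (f : X -> Y) (x : X) : differentiable f x ->
  forall e : R, 0 < e -> exists2 d : R, 0 < d & forall h, rnorm h < d ->
    rnorm (f (h + x) - f x - 'd f x h) <= e * rnorm h.
Proof.
move=> /diff_locally/eqaddoP fo e e0.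
have /nbhs_ballP[d /= d0 Hd] := fo e%:C ltac:(by rewrite ltcR).
have dE : d = (complex.Re d)%:C.
  by move: d0; case: (d) => a b; rewrite ltcE /= => /andP[/eqP -> _].
exists (complex.Re d); first by rewrite -ltcR -dE.
move=> h hd; have /Hd : ball (0 : X) d h.
  by rewrite -ball_normE /ball_/= sub0r normrN -rnormE dE ltcR.
have -> : (f \o shift x - (cst (f x) + 'd f x)) h = f (h + x) - f x - 'd f x h.
  by rewrite -[LHS]/(f (h + x) - (f x + 'd f x h)) opprD addrA.
by rewrite /= -!rnormE -rmorphM lecR.
Qed.

(** The differential is linear over the complex numbers, so along the plane it acts through [T] as
    multiplication by [a +i* b]; the two functions are the real and imaginary parts of K - T f. [K]
    will be |g|, which makes the first one nonnegative. *)
Lemma differentiable_cauchy_riemann (f : X -> Y) (T : dual Y) (p w : X) (K x y : R) :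
  differentiable f (p + (x +i* y) *: w) ->
  cauchy_riemann (fun s t => K - complex.Re (T (f (p + (s +i* t) *: w))))
    (fun s t => - complex.Im (T (f (p + (s +i* t) *: w)))) x y.
Proof.
set q := p + _ => df.
have [a b cE] : exists2 a, True & exists b, T ('d f q w) = a +i* b.
  by case: (T ('d f q w)) => a b; exists a => //; exists b.
have {b cE}[b cE] := cE.
exists (- a), (- b) => e e0.
have e'0 : 0 < e / (rnorm T * rnorm w + 1).
  by rewrite divr_gt0 // ltr_wpDl // mulr_ge0 // rnorm_ge0.
have [d d0 Hd] := differentiable_expansion df e'0.
have w1 : 0 < rnorm w + 1 by rewrite ltr_wpDl // rnorm_ge0.
exists (d / 2 / (rnorm w + 1)); first by rewrite !divr_gt0.
move=> s t; rewrite !ltr_pdivlMr // => sd td.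
set h := (s +i* t) *: w.
have hst : rnorm h <= (`|s| + `|t|) * rnorm w.
  by rewrite rnormZ ler_wpM2r ?rnorm_ge0 // rnorm_complex_le.
have hd : rnorm h < d.
  apply: (@le_lt_trans _ _ ((`|s| + `|t|) * (rnorm w + 1))).
    by apply: le_trans hst _; rewrite ler_wpM2l ?addr_ge0 // lerDl.
  by rewrite mulrDl [ltRHS]splitr; apply: ltrD; rewrite ltr_pdivlMr.
have -> : p + ((x + s) +i* (y + t)) *: w = h + q.
  rewrite /h /q [RHS]addrCA -scalerDl; congr (p + _ *: w).
  by apply/eqP; rewrite eq_complex /= [s + x]addrC [t + y]addrC !eqxx.
pose z := T (f (h + q) - f q - 'd f q h).
have zE : z = T (f (h + q)) - T (f q) - (s +i* t) * (a +i* b).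
  by rewrite /z !dual_sub /h linearZ dualZ cE.
have zle : rnorm (z : R[i]) <= e * (`|s| + `|t|).
  apply: le_trans (dual_le _ _) _; apply: le_trans (ler_wpM2l (rnorm_ge0 _) (Hd h hd)) _.
  apply: (@le_trans _ _ (rnorm T * (e / (rnorm T * rnorm w + 1) * ((`|s| + `|t|) * rnorm w)))).
    by apply: ler_wpM2l; [exact: rnorm_ge0|apply: ler_wpM2l; [exact: ltW|]].
  rewrite (_ : _ * (_ * _) = e * (`|s| + `|t|) * (rnorm T * rnorm w / (rnorm T * rnorm w + 1))); last by ring.
  rewrite ler_piMr ?mulr_ge0 ?(ltW e0) ?addr_ge0 //.
  by rewrite ler_pdivrMr ?ltr_wpDl ?mulr_ge0 ?rnorm_ge0 // mul1r lerDl.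
move: zE zle (Re_le_rnorm z) (Im_le_rnorm z).
case: z (T (f (h + q))) (T (f q)) => z1 z2 [a1 b1] [a2 b2] [-> ->] zle Rz Iz.
split.
  apply: le_trans zle; apply: le_trans Rz.
  by rewrite /= -normrN le_eqVlt; apply/orP; left; apply/eqP; congr `|_|; ring.
apply: le_trans zle; apply: le_trans Iz.
by rewrite /= -normrN le_eqVlt; apply/orP; left; apply/eqP; congr `|_|; ring.
Qed.

End Differentials.

(** * Norm attaining maps into the bidual *)

Section Main.
Variable R : realType.
Local Notation Z := (renormed_c0 R).
Local Notation Z'' := (dual (dual Z)).
Local Notation A := (Au (c0 R) Z'').

Definition c0_eval (x : c0 R) : Z'' := bidual_eval (x : Z).

Lemma c0_eval_linear : linear c0_eval.
Proof. by move=> a x y; exact: (bidual_eval_linear a (x : Z) (y : Z)). Qed.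

HB.instance Definition _ := GRing.isLinear.Build _ _ _ _ c0_eval c0_eval_linear.

Lemma c0_eval_le (x : c0 R) : rnorm (c0_eval x) <= 2 * rnorm x.
Proof. exact: le_trans (bidual_eval_le _) (rnorm_le2 _). Qed.

Definition ball_inclusion (x : c0 R) : Z'' :=
  if `[< unit_ball (c0 R) x >] then c0_eval x else 0.

Lemma ball_inclusionE x : unit_ball (c0 R) x -> ball_inclusion x = c0_eval x.
Proof. by move=> x1; rewrite /ball_inclusion asboolT. Qed.

Lemma ball_inclusion_subproof : ball_inclusion \in @Au_pred R (c0 R) Z''.
Proof.
apply/Au_predP; split.
- by move=> x x1; rewrite /ball_inclusion asboolF.
- apply/unif_continuous_subspaceP => e e0; exists (e / 2); first by rewrite divr_gt0.
  move=> x y x1 y1; rewrite ltr_pdivlMr // mulrC => xy.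
  by rewrite !ball_inclusionE // -linearB; exact: le_lt_trans (c0_eval_le _) xy.
- move=> x x1; apply: (@near_linear_differentiable _ _ _ _ c0_eval).
    by apply: (rnorm_bounded_continuous (M := 2)) => //; exact: c0_eval_le.
  have d0 : 0 < 1 - `|x| by rewrite subr_gt0.
  apply: filterS (nbhsx_ballx x _ d0) => y.
  rewrite -ball_normE /ball_/= => xy; apply: ball_inclusionE; rewrite /unit_ball /=.
  rewrite -[y](subrK x) (le_trans (ler_normD _ _)) // -lerBrDr distrC.
  exact: ltW.
Qed.

Definition inclusion : A := MkAu ball_inclusion_subproof.

Lemma Au_le (g : A) x : unit_ball (c0 R) x -> rnorm (g x) <= rnorm g.
Proof. by move=> x1; apply: supnorm_ub => //; exact: Au_bounded. Qed.

Lemma unit_ball_scale (r : R) (x : c0 R) : 0 <= r -> r <= 1 ->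
  unit_ball (c0 R) x -> unit_ball (c0 R) (r%:C *: x).
Proof.
move=> r0 r1 /unit_ballE x1; apply/unit_ballE.
by rewrite rnormZ rnormC ger0_norm // mulr_ile1 // rnorm_ge0.
Qed.

(** If Re g(x + y)(Phi) were below |g| - d, then [u] would be at least d/2 on a disc about x + y
    whose radius [eta] depends only on [g] and [d]. Harnack's inequality would give [u] at least
    [kappa] next to x, while [Phi] norms g(x) up to [kappa / 2]. *)
Lemma norm_attaining_segment (g : A) (x y : c0 R) (d : R) :
  unit_ball (c0 R) x -> `|g x| = `|g| ->
  (forall z : R[i], rnorm (z : R[i]) <= 7 -> unit_ball (c0 R) (x + z *: y)) ->
  rnorm y <= 1 -> 0 < d ->
  exists2 Phi, unit_ball (dual Z) Phi &
    rnorm g - d <= complex.Re (g x Phi) /\ rnorm g - d <= complex.Re (g (x + y) Phi).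
Proof.
move=> x1 gx xyB y1 d0; set M := rnorm g.
have Mx : rnorm (g x) = M by rewrite /rnorm gx.
have gC (p : c0 R) (Phi : dual Z) : unit_ball (c0 R) p -> unit_ball _ Phi ->
    rnorm (g p Phi : R[i]) <= M.
  move=> p1 /unit_ballE Phi1; apply: le_trans (dual_le _ _) _.
  by apply: le_trans (Au_le g p1); rewrite ler_piMr // rnorm_ge0.
have gB (p q : c0 R) (Phi : dual Z) (e : R) : unit_ball _ Phi ->
    rnorm (g p - g q) < e -> complex.Re (g p Phi) < complex.Re (g q Phi) + e.
  move=> /unit_ballE Phi1 pq; rewrite -ltrBlDl.
  apply: le_lt_trans pq; have -> : complex.Re (g p Phi) - complex.Re (g q Phi) =
    complex.Re ((g p - g q) Phi).
    by rewrite -[(g p - g q) Phi]/(g p Phi - g q Phi); case: (g p Phi) (g q Phi) => ? ? [? ?].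
  apply: le_trans (ler_norm _) _; apply: le_trans (Re_le_rnorm _) _.
  by apply: le_trans (dual_le _ _) _; rewrite ler_piMr // rnorm_ge0.
have /unif_continuous_subspaceP gu := @Au_unif_continuous _ _ _ g.
have d40 : 0 < d / 4 by rewrite divr_gt0.
have [d1 d10 Hd1] := gu _ d40.
pose eta := Num.min 1 d1.
have eta0 : 0 < eta by rewrite lt_min ltr01.
have eta1 : eta <= 1 by rewrite ge_min lexx.
have etad : eta <= d1 by rewrite ge_min lexx orbT.
have dd0 : 0 < d / 2 by rewrite divr_gt0.
set kappa := 3 * (d / 2) * eta ^+ 2 / 16.
have k0 : 0 < kappa by rewrite divr_gt0 // !mulr_gt0 // exprn_gt0.
have k40 : 0 < kappa / 4 by rewrite divr_gt0.
have [d2 d20 Hd2] := gu _ k40.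
have m0 : 0 < Num.min (kappa / 2) d by rewrite lt_min d0 divr_gt0.
have [Phi Phi1 HPhi] := norming (g x) m0; rewrite Mx in HPhi.
have [mk md] : Num.min (kappa / 2) d <= kappa / 2 /\ Num.min (kappa / 2) d <= d.
  by split; rewrite ge_min lexx ?orbT.
exists Phi => //; split; first by lra.
rewrite leNgt; apply/negP => Gd.
(* Differentiability is available only in the open ball, so the plane is contracted by [r < 1]. By
   uniform continuity this costs less than [d / 4] at x + y and less than [kappa / 4] at x. *)
pose r := 1 - Num.min 2^-1 (Num.min (d1 / 2) (d2 / 2)).
have [r12 r1d1 r1d2] : [/\ 1 - r <= 2^-1, 1 - r <= d1 / 2 & 1 - r <= d2 / 2].
  by rewrite /r opprB addrCA subrr addr0 !ge_min !lexx !orbT.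
have r1 : r < 1 by rewrite /r ltrBlDr ltrDl !lt_min invr_gt0 ltr0n !divr_gt0.
have r0 : 0 < r by move: r12; clear => r12; lra.
have rdist (p : c0 R) : unit_ball (c0 R) p -> rnorm (r%:C *: p - p) <= 1 - r.
  move=> /unit_ballE p1; rewrite -{2}[p]scale1r -scalerBl rnormZ.
  have -> : r%:C - 1 = (r - 1)%:C by apply/eqP; rewrite eq_complex /= subrr !eqxx.
  by rewrite rnormC distrC ger0_norm ?subr_ge0 ?(ltW r1) // ler_piMr // subr_ge0 ltW.
pose p := r%:C *: (x + y); pose w := r%:C *: y.
have xyB1 : unit_ball (c0 R) (x + y).
  by rewrite -[y]scale1r; apply: xyB; rewrite -[1]/(1%:C) rnormC normr1 ler1n.
have pwE z : p + z *: w = r%:C *: (x + (1 + z) *: y).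
  by rewrite /p /w !scalerDr scalerA mulrC -scalerA scalerDl scale1r scalerDr addrA.
(* The square of half side 3 is centred at x + y, that is at parameter 1 on the line from x: hence 7
   = 1 + 3 + 3. *)
have sq7 (s t : R) : `|s| <= 3 -> `|t| <= 3 -> rnorm (1 + (s +i* t) : R[i]) <= 7.
  move=> s3 t3; apply: le_trans (rnormD _ _) _.
  have := rnorm_complex_le s t; rewrite -[1]/(1%:C) rnormC normr1.
  by move: s3 t3; clear => *; lra.
have pwB s t : `|s| <= 3 -> `|t| <= 3 -> unit_ball (c0 R) (p + (s +i* t) *: w).
  move=> s3 t3; rewrite pwE; apply: unit_ball_scale; [exact: ltW|exact: ltW|].
  by apply: xyB; exact: sq7.
pose T := bidual_eval Phi : dual Z''.
pose u s t := M - complex.Re (T (g (p + (s +i* t) *: w))).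
pose v s t := - complex.Im (T (g (p + (s +i* t) *: w))).
have TE s t : T (g (p + (s +i* t) *: w)) = g (p + (s +i* t) *: w) Phi by [].
have uvCR s t : `|s| <= 3 -> `|t| <= 3 -> cauchy_riemann u v s t.
  move=> s3 t3; apply: differentiable_cauchy_riemann; apply: Au_differentiable.
  rewrite -rnormE -(rmorph1 (real_complex R)) ltcR pwE rnormZ rnormC ger0_norm ?(ltW r0) //.
  have /unit_ballE z1 := xyB _ (sq7 s t s3 t3).
  by apply: le_lt_trans r1; rewrite ler_piMr // ltW.
have gM s t : `|s| <= 3 -> `|t| <= 3 -> rnorm (T (g (p + (s +i* t) *: w)) : R[i]) <= M.
  by move=> s3 t3; rewrite TE; apply: gC => //; exact: pwB.
have M0 : 0 <= M by exact: rnorm_ge0.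
have uC s t : `|s| <= 3 -> `|t| <= 3 -> `|u s t| <= 2 * M.
  move=> s3 t3; apply: le_trans (ler_normB _ _) _; rewrite ger0_norm //.
  by rewrite mulr_natl mulr2n lerD2l (le_trans (Re_le_rnorm _)) // gM.
have vC s t : `|s| <= 3 -> `|t| <= 3 -> `|v s t| <= 2 * M.
  move=> s3 t3; rewrite normrN (le_trans (Im_le_rnorm _)) // (le_trans (gM s t s3 t3)) //.
  by rewrite mulr_natl mulr2n lerDl.
have u0 s t : `|s| <= 3 -> `|t| <= 3 -> 0 <= u s t.
  move=> s3 t3; rewrite subr_ge0 (le_trans (ler_norm _)) //.
  by rewrite (le_trans (Re_le_rnorm _)) // gM.
have uc (s t : R) : s ^+ 2 + t ^+ 2 <= eta ^+ 2 -> d / 2 <= u s t.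
  move=> st.
  have le3 (z : R) : z ^+ 2 <= eta ^+ 2 -> `|z| <= 3.
    move=> ze; apply: (@le_trans _ _ 1); last by rewrite ler1n.
    apply: le_trans eta1.
    by rewrite -(@ler_pXn2r _ 2) ?nnegrE ?(ltW eta0) // real_normK ?num_real.
  have s3 : `|s| <= 3 by apply: le3; apply: le_trans st; rewrite lerDl sqr_ge0.
  have t3 : `|t| <= 3 by apply: le3; apply: le_trans st; rewrite lerDr sqr_ge0.
  have st1 : rnorm (s +i* t : R[i]) <= eta.
    by rewrite -(@ler_pXn2r _ 2) ?nnegrE ?rnorm_ge0 ?(ltW eta0) // rnorm_sqr.
  have n1 : rnorm (g (p + (s +i* t) *: w) - g p) < d / 4.
    apply: Hd1; [exact: pwB|by apply: unit_ball_scale => //; exact: ltW|].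
    rewrite addrAC subrr add0r rnormZ /w rnormZ rnormC ger0_norm ?(ltW r0) //.
    apply: lt_le_trans etad; apply: le_lt_trans (_ : eta * r < _).
      apply: ler_pM => //; rewrite ?mulr_ge0 ?rnorm_ge0 ?(ltW r0) //.
      by rewrite ler_piMr // ltW.
    by rewrite gtr_pMr.
  have n2 : rnorm (g p - g (x + y)) < d / 4.
    apply: Hd1 => //; first by apply: unit_ball_scale => //; exact: ltW.
    by apply: le_lt_trans (rdist _ xyB1) _; lra.
  have := gB _ _ _ _ Phi1 n1; have := gB _ _ _ _ Phi1 n2.
  rewrite /u TE; lra.
have := harnack dd0 eta0 eta1 uvCR uC vC u0 uc.
have -> : u (-1) 0 = M - complex.Re (g (r%:C *: x) Phi).
  rewrite /u TE pwE (_ : 1 + (-1 +i* 0) = 0) ?scale0r ?addr0 //.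
  by apply/eqP; rewrite eq_complex /= subrr addr0 !eqxx.
have n3 : rnorm (g x - g (r%:C *: x)) < kappa / 4.
  apply: Hd2 => //; first by apply: unit_ball_scale => //; exact: ltW.
  rewrite -opprB rnormN; apply: le_lt_trans (rdist _ x1) _; lra.
have := gB _ _ _ _ Phi1 n3; rewrite -/kappa; lra.
Qed.

End Main.

Theorem proposition4p8 (R : realType) :
  ~ dense (norm_attaining (c0 R) (dual (dual (renormed_c0 R)))).
Proof.
pose J := inclusion R; pose e : R := 64^-1.
have e0 : (0 : R[i]) < e%:C by rewrite ltcR invr_gt0.
move=> /(_ (ball J e%:C)) [||g [Jg [x x1 gx]]].
- by exists J; exact: ballxx.
- exact: ball_open.
have {}Jg : rnorm (J - g) < e.
  by move: Jg; rewrite -ball_normE /ball_/= -rnormE ltcR.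
have /unit_ballE x1' := x1.
(* With [y] of size 1/16, the disc of radius 7 stays in the unit ball because 1/4 + 7/16 < 1. *)
have [n xn] : exists n, rnorm (x n : R[i]) <= 4^-1.
  have /cvgrPdist_lt := c0_cvg x => /(_ (4^-1)%:C).
  rewrite ltcR invr_gt0 ltr0n => /(_ isT)[n _ Hn]; exists n.
  by have /= := Hn n (leqnn n); rewrite sub0r normrN -rnormE ltcR => /ltW.
pose y : c0 R := (16^-1)%:C *: c0_basis R n.
have yE k : y k = (16^-1)%:C * (k == n)%:R by rewrite c0_scaleE c0_basisE.
have y16 k : rnorm (y k : R[i]) <= 16^-1.
  rewrite yE; case: (k == n); rewrite ?mulr0 ?rnorm0 ?invr_ge0 // mulr1 rnormC.
  by rewrite ger0_norm // invr_ge0.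
have y1 : rnorm y <= 1.
  apply: (@supnorm_le _ _ _ _ 0%N) => // k _; apply: le_trans (y16 k) _; lra.
have xyB (z : R[i]) : rnorm (z : R[i]) <= 7 -> unit_ball (c0 R) (x + z *: y).
  move=> z7; apply/unit_ballE; apply: (@supnorm_le _ _ _ _ 0%N) => // k _.
  rewrite c0_addE c0_scaleE.
  have [->|kn] := eqVneq k n; last first.
    rewrite yE (negbTE kn) !mulr0 addr0; exact: le_trans (c0_le x k) x1'.
  apply: le_trans (rnormD _ _) _; rewrite rnormM.
  have : rnorm (z : R[i]) * rnorm (y n : R[i]) <= 7 * 16^-1.
    by apply: ler_pM; rewrite ?rnorm_ge0.
  lra.
have xyB1 : unit_ball (c0 R) (x + y).
  by rewrite -[y]scale1r; apply: xyB; rewrite -[1]/(1%:C) rnormC normr1 ler1n.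
have FG : 2 * rnorm g <= rnorm (g x + g (x + y)).
  apply/ler_addgt0Pl => d d0.
  have d20 : 0 < d / 2 by rewrite divr_gt0.
  have [Phi /unit_ballE Phi1 [h1 h2]] := norm_attaining_segment x1 gx xyB y1 d20.
  rewrite -lerBlDl.
  apply: (@le_trans _ _ (complex.Re ((g x + g (x + y)) Phi))).
    rewrite -[(g x + g (x + y)) Phi]/(g x Phi + g (x + y) Phi).
    by move: h1 h2; case: (g x Phi) (g (x + y) Phi) => ? ? [? ?] /=; lra.
  apply: le_trans (ler_norm _) _; apply: le_trans (Re_le_rnorm _) _.
  by apply: le_trans (dual_le _ _) _; rewrite ler_piMr // rnorm_ge0.
have gn := bidual_strict_convex (Au_le g x1) (Au_le g xyB1) FG n.
have Jn z : unit_ball (c0 R) z -> rnorm (z n - g z (c0_coord R n) : R[i]) < e.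
  move=> z1; apply: le_lt_trans Jg; apply: le_trans (Au_le (J - g) z1).
  have -> : z n - g z (c0_coord R n) = (J - g) z (c0_coord R n).
    rewrite -[RHS]/(ball_inclusion z (c0_coord R n) - g z (c0_coord R n)).
    by rewrite ball_inclusionE.
  apply: le_trans (dual_le _ _) _; rewrite ler_piMr ?rnorm_ge0 //.
  exact: c0_coord_le1.
(* From x to x + y the coordinate [n] of J moves by 1/16 and that of [g] not at all, whereas
   closeness at the two points allows a discrepancy below 2/64. *)
have := Jn _ x1; have := Jn _ xyB1; rewrite -gn.
have : rnorm (y n : R[i]) = 16^-1.
  by rewrite yE eqxx mulr1 rnormC ger0_norm // invr_ge0.
have -> : y n = (x + y) n - g x (c0_coord R n) - (x n - g x (c0_coord R n)).
  by rewrite c0_addE; ring.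
move=> h1 h2 h3.
have := rnormD ((x + y) n - g x (c0_coord R n) : R[i]) (- (x n - g x (c0_coord R n))).
rewrite rnormN h1 /e; move: h2 h3; rewrite /e; lra.
Qed.
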